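(* Let $G\in\mathcal{S}^\star$ have the cancellation property. Suppose that $G=V\oplus G'$ with $V$ finite, and that there are subgroups $F,L,K\le G'$ forming a pushout presentation of $G'$ (as defined in the context), together with a decomposition $L=F_1\oplus L_1$ in which $F_1$ is free and $L_1$ has no nonzero free direct summands, such that at least one of the following holds: (a) $K$ is free; (b) $L$ is free; (c) $L_1\in\mathcal{G}$; (d) the rank of $F_1$ is at most $1$; (e) $r_0(L_1)=1$; (f) $r_0(L_1)=2$. Then the Walk-endomorphism ring $\mathrm{End}_{\mathrm{W}}(G)=\mathrm{End}(G)/\mathrm{Hom}(G,T(G))$ has the unit lifting property.
   Context: All groups are abelian. $T(G)$ is the torsion part of $G$, $T_p(G)$ (also written $G_p$ when $G$ is a torsion group, and $(X)_p$ for the $p$-component of a group $X$) is the $p$-component, and $r_0(G)=\dim_{\mathbb{Q}}(\mathbb{Q}\otimes G)$ is the torsion-free rank. A group $G$ is self-small if for every set $I$ the canonical homomorphism $\mathrm{Hom}(G,G)^{(I)}\to \mathrm{Hom}(G,G^{(I)})$ is an isomorphism. $\mathcal{S}$ is the class of self-small groups of finite torsion-free rank, and $\mathcal{S}^\star$ is the class of reduced groups in $\mathcal{S}$ without nonzero free direct summands. $\mathcal{G}$ is the class of groups $A\in\mathcal{S}$ such that $A/T(A)$ is divisible. A full free subgroup of a group $A$ of finite torsion-free rank is a free subgroup $F\le A$ such that $A/F$ is a torsion group. A group $A$ of finite torsion-free rank is quotient-divisible if $T(A)$ is reduced and there is a full free subgroup $F\le A$ with $A/F$ divisible. Pushout presentation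 of a group $G'$: subgroups $F\le L\le G'$ and $F\le K\le G'$ such that the commutative square of inclusions $F\to K$, $F\to L$, $K\to G'$, $L\to G'$ is a pushout square (so it extends to a commutative diagram with exact rows $0\to F\to K\to K/F\to 0$ and $0\to L\to G'\to K/F\to 0$ and identity on $K/F$), and such that (1) $F$ is a full free subgroup of $G'$, and $G'/F$ is $p$-divisible for all primes $p$ with $T_p(G')\neq 0$; (2) $L$ is quotient-divisible, $T(G')\le L$, and $L/F$ is divisible; (3) $K$ is torsion-free and $K/F$ is reduced; (4) for every prime $p$, $(G'/L)_p=0$ or $T_p(G')=0$. A group $G$ has the cancellation property if whenever $A,B$ are (abelian) groups with $G\oplus A\cong G\oplus B$, it follows that $A\cong B$. A ring $R$ has the unit lifting property if for every positive integer $n$ every unit of $R/nR$ can be lifted to a unit of $R$. In $\mathrm{End}_{\mathrm{W}}(G)$, $\mathrm{Hom}(G,T(G))$ is viewed as the ideal of endomorphisms with image in $T(G)$. *)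

(* Defs.v *)
From HB Require Import structures.
From mathcomp Require Import all_boot all_order all_algebra.
From mathcomp Require Import generic_quotient ring_quotient.
From mathcomp Require Import ring.
From mathcomp Require Import boolp classical_sets functions cardinality.

Set Implicit Arguments.
Unset Strict Implicit.
Unset Printing Implicit Defensive.

Import Order.TTheory GRing.Theory Num.Theory Quotient.
Local Open Scope ring_scope.
Local Open Scope quotient_scope.

(* An abelian group is a [zmodType], a subgroup of [G] is a [zmodClosed G]
   (a boolean predicate: with [asbool] this covers every subgroup), and [{quot H}]
   is the quotient group. *)

Definition subg (G : zmodType) (H : zmodClosed G) : Type := {x : G | x \in H}.
HB.instance Definition _ G (H : zmodClosed G) := SubChoice.on (@subg G H).
HB.instance Definition _ G (H : zmodClosed G) :=
  [SubChoice_isSubZmodule of @subg G H by <:].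

Definition trivialg (G : zmodType) (H : {pred G}) : Prop :=
  forall x, x \in H -> x = 0.

Definition is_direct_sum (G : zmodType) (C : {pred G}) (A B : zmodClosed G) : Prop :=
  (forall x, x \in C <-> exists a b, [/\ a \in A, b \in B & x = a + b]) /\
  (forall x, x \in A -> x \in B -> x = 0).

Section Restrict.
Variables (G : zmodType) (H F : zmodClosed G).

Definition restrictg : {pred subg H} := [pred x | val x \in F].

Fact restrictg_closed : zmod_closed restrictg.
Proof.
by split=> [|x y xF yF]; rewrite inE ?raddf0 ?rpred0 // raddfB rpredB.
Qed.
HB.instance Definition _ := GRing.isZmodClosed.Build _ restrictg restrictg_closed.

(* the group H / F; only used for F contained in H *)
Definition quotg : zmodType := {quot restrictg}.
End Restrict.

Section Inclusion.
Variables (G : zmodType) (A B : zmodClosed G) (sAB : {subset A <= B}).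

Definition inclg (x : subg A) : subg B := exist _ (val x) (sAB (valP x)).

Fact inclg_additive : zmod_morphism inclg.
Proof. by move=> x y; apply: val_inj; rewrite !raddfB. Qed.
HB.instance Definition _ :=
  GRing.isZmodMorphism.Build (subg A) (subg B) inclg inclg_additive.
End Inclusion.

Section Torsion.
Variable G : zmodType.

Definition tors : {pred G} := [pred x | `[< exists n, (0 < n)%N /\ x *+ n = 0 >]].

Fact tors_closed : zmod_closed tors.
Proof.
split=> [|x y /asboolP[n [n0 xn]] /asboolP[m [m0 ym]]]; apply/asboolP.
  by exists 1%N; rewrite mul0rn.
exists (n * m)%N; rewrite muln_gt0 n0 m0 mulrnBl; split=> //.
by rewrite mulrnA xn mul0rn mulnC mulrnA ym mul0rn subrr.
Qed.
HB.instance Definition _ := GRing.isZmodClosed.Build _ tors tors_closed.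

Definition tors_p (p : nat) : {pred G} := [pred x | `[< exists k, x *+ (p ^ k)%N = 0 >]].

Fact tors_p_closed p : zmod_closed (tors_p p).
Proof.
split=> [|x y /asboolP[k xk] /asboolP[l yl]]; apply/asboolP.
  by exists 0; rewrite mul0rn.
exists (k + l)%N; rewrite expnD mulrnBl.
by rewrite mulrnA xk mul0rn mulnC mulrnA yl mul0rn subrr.
Qed.
HB.instance Definition _ p := GRing.isZmodClosed.Build _ (tors_p p) (tors_p_closed p).

Definition torsion_group : Prop := forall x : G, x \in tors.
Definition torsion_free : Prop := trivialg tors.
Definition pdivisible (p : nat) : Prop := forall x : G, exists y, y *+ p = x.
Definition divisible : Prop := forall n, (0 < n)%N -> pdivisible n.
End Torsion.
Arguments tors G : clear implicits.
Arguments tors_p G p : clear implicits.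

Definition reduced (G : zmodType) : Prop :=
  forall D : zmodClosed G, divisible (subg D) -> trivialg D.

Section Hom.
Variables G H : zmodType.
Implicit Types f g h : {additive G -> H}.

Lemma hom_ext f g : f =1 g -> f = g.
Proof.
case: f g => [f [[fP]]] [g [[gP]]] /= /funext fg.
by subst g; rewrite (Prop_irrelevance fP gP).
Qed.

HB.instance Definition _ := gen_eqMixin {additive G -> H}.
HB.instance Definition _ := gen_choiceMixin {additive G -> H}.

Definition hom_zero : {additive G -> H} := \0.
Definition hom_opp f : {additive G -> H} := \- f.
Definition hom_add f g : {additive G -> H} := f \+ g.

Fact hom_addA : associative hom_add.
Proof. by move=> f g h; apply: hom_ext => x /=; rewrite addrA. Qed.
Fact hom_addC : commutative hom_add.
Proof. by move=> f g; apply: hom_ext => x /=; rewrite addrC. Qed.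
Fact hom_add0 : left_id hom_zero hom_add.
Proof. by move=> f; apply: hom_ext => x /=; rewrite add0r. Qed.
Fact hom_addN : left_inverse hom_zero hom_opp hom_add.
Proof. by move=> f; apply: hom_ext => x /=; rewrite addNr. Qed.

HB.instance Definition _ := GRing.isZmodule.Build {additive G -> H}
  hom_addA hom_addC hom_add0 hom_addN.
End Hom.

Definition isog (G H : zmodType) : Prop :=
  exists f : {additive G -> H}, bijective f.

Section DirectSum.
Variables (I : Type) (G : zmodType).

Definition fin_supp : {pred I -> G} :=
  [pred f | `[< finite_set [set i | f i != 0] >]].

Fact fin_supp_closed : zmod_closed fin_supp.
Proof.
split=> [|f g /asboolP fF /asboolP gF]; apply/asboolP.
  by apply: (sub_finite_set _ (finite_set0 I)) => i /=; rewrite eqxx.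
have fgF : finite_set ([set i | f i != 0] `|` [set i | g i != 0])%classic.
  by rewrite finite_setU.
apply: sub_finite_set fgF => i /=; have [f0|] := eqVneq (f i) 0; last by left.
have [g0|] := eqVneq (g i) 0; last by right.
by rewrite !fctE f0 g0 subr0 eqxx.
Qed.
HB.instance Definition _ := GRing.isZmodClosed.Build _ fin_supp fin_supp_closed.

Definition dsum : zmodType := subg fin_supp.
End DirectSum.

Section HomDirectSum.
Variables (I : Type) (G H : zmodType).
Implicit Type f : dsum I {additive G -> H}.

Fact dsum_hom_subproof f x : (fun i => val f i x) \in @fin_supp I H.
Proof.
have /asboolP fF := valP f; apply/asboolP; apply: sub_finite_set fF => i /=.
by apply: contra_neq => ->.
Qed.

Definition dsum_hom_fun f (x : G) : dsum I H :=
  exist (fun g => g \in @fin_supp I H) _ (dsum_hom_subproof f x).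

Fact dsum_hom_fun_additive f : zmod_morphism (dsum_hom_fun f).
Proof. by move=> x y; apply: val_inj; apply: funext => i /=; rewrite raddfB. Qed.
HB.instance Definition _ f :=
  GRing.isZmodMorphism.Build G (dsum I H) (dsum_hom_fun f) (dsum_hom_fun_additive f).

(* the canonical homomorphism Hom(G, H)^(I) -> Hom(G, H^(I)) *)
Definition dsum_hom f : {additive G -> dsum I H} := dsum_hom_fun f.

Fact dsum_hom_additive : zmod_morphism dsum_hom.
Proof. by move=> f g; apply: hom_ext => x; apply: val_inj; apply: funext. Qed.
HB.instance Definition _ := GRing.isZmodMorphism.Build
  (dsum I {additive G -> H}) {additive G -> dsum I H} dsum_hom dsum_hom_additive.
End HomDirectSum.

Definition self_small (G : zmodType) : Prop :=
  forall I : Type, bijective (@dsum_hom I G G).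

Definition free_group (G : zmodType) : Prop := exists I : Type, isog (dsum I int) G.

Definition no_free_summand (G : zmodType) : Prop :=
  forall F B : zmodClosed G, is_direct_sum predT F B -> free_group (subg F) -> trivialg F.

(* Q (x) G, constructed as the localization of G at the nonzero integers: a pair
   [(x, n)] stands for 1/(n + 1) (x) x. That this is the tensor product over Z is
   [tensQ_universal] below. *)
Section TensQ.
Variable G : zmodType.
Implicit Types (x y : G) (d e : nat).

Definition locq_rel (u v : G * nat) : bool :=
  `[< exists2 k, (0 < k)%N & u.1 *+ (v.2.+1 * k) = v.1 *+ (u.2.+1 * k) >].

Fact locq_equiv : equiv_class_of locq_rel.
Proof.
split=> [u|u v|[y m] [x n] [z l]].
- by apply/asboolP; exists 1%N.
- by apply/asboolP/asboolP => -[k k0 e]; exists k.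
move=> /asboolP[/= k k0 e] /asboolP[/= k' k'0 e']; apply/asboolP => /=.
exists (m.+1 * k * k')%N; first by rewrite !muln_gt0 k0 k'0.
have -> : (l.+1 * (m.+1 * k * k') = m.+1 * k * (l.+1 * k'))%N by ring.
rewrite mulrnA e -mulrnA.
have -> : (n.+1 * k * (l.+1 * k') = l.+1 * k' * (n.+1 * k))%N by ring.
by rewrite mulrnA e' -mulrnA; congr (_ *+ _); ring.
Qed.
Canonical locq_equivRel := EquivRelPack locq_equiv.
Canonical locq_encModRel := defaultEncModRel locq_rel.

Definition tensQ : Type := {eq_quot locq_rel}.
HB.instance Definition _ := Choice.on tensQ.
HB.instance Definition _ := EqQuotient.on tensQ.

(* the element 1/d (x) x, for d > 0 *)
Definition locq x d : tensQ := \pi_tensQ (x, d.-1).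

Lemma locqP x y d e : (0 < d)%N -> (0 < e)%N ->
  locq x d = locq y e <-> exists2 k, (0 < k)%N & x *+ (e * k) = y *+ (d * k).
Proof.
move=> d0 e0; rewrite -{2}(prednK d0) -{2}(prednK e0).
split=> [/eqP|H]; first by rewrite /locq piE => /asboolP.
by apply/eqP; rewrite /locq piE; apply/asboolP.
Qed.

Lemma locq_surj (u : tensQ) : exists x d, (0 < d)%N /\ u = locq x d.
Proof.
by exists (repr u).1, (repr u).2.+1; split=> //; rewrite /locq /= -surjective_pairing reprK.
Qed.

Definition locq_add (u v : tensQ) : tensQ :=
  locq ((repr u).1 *+ (repr v).2.+1 + (repr v).1 *+ (repr u).2.+1)
        ((repr u).2.+1 * (repr v).2.+1).
Definition locq_opp (u : tensQ) : tensQ := locq (- (repr u).1) (repr u).2.+1.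
Definition locq_scale (a : rat) (u : tensQ) : tensQ :=
  locq ((repr u).1 *~ numq a) (`|denq a| * (repr u).2.+1).

Lemma repr_locq x d : (0 < d)%N ->
  exists2 k, (0 < k)%N & (repr (locq x d)).1 *+ (d * k) =
                         x *+ ((repr (locq x d)).2.+1 * k).
Proof.
by move=> d0; apply/locqP=> //; rewrite /locq /= -surjective_pairing reprK.
Qed.

Lemma locq_addE x y d e : (0 < d)%N -> (0 < e)%N ->
  locq_add (locq x d) (locq y e) = locq (x *+ e + y *+ d) (d * e).
Proof.
move=> d0 e0; rewrite /locq_add.
have [k k0] := repr_locq x d0; have [l l0] := repr_locq y e0.
move: (repr _) => [y' e'] /= eqy; move: (repr _) => [x' d'] /= eqx.
apply/locqP; rewrite ?muln_gt0 ?d0 ?e0 //.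
exists (k * l)%N; first by rewrite muln_gt0 k0.
rewrite !mulrnDl -!mulrnA; congr (_ + _).
  have -> : (e'.+1 * (d * e * (k * l)) = d * k * (e'.+1 * e * l))%N by ring.
  by rewrite mulrnA eqx -mulrnA; congr (_ *+ _); ring.
have -> : (d'.+1 * (d * e * (k * l)) = e * l * (d'.+1 * d * k))%N by ring.
by rewrite mulrnA eqy -mulrnA; congr (_ *+ _); ring.
Qed.

Lemma locq_oppE x d : (0 < d)%N -> locq_opp (locq x d) = locq (- x) d.
Proof.
move=> d0; have [k k0 e] := repr_locq x d0.
by apply/locqP=> //; exists k => //; rewrite !mulNrn e.
Qed.

Lemma locq_eq1 x y d e : (0 < d)%N -> (0 < e)%N -> x *+ e = y *+ d ->
  locq x d = locq y e.
Proof. by move=> d0 e0 exy; apply/locqP=> //; exists 1%N; rewrite ?muln1. Qed.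

Lemma locq_eqz x y d e : (0 < d)%N -> (0 < e)%N -> x *~ e = y *~ d ->
  locq x d = locq y e.
Proof. by rewrite -!pmulrn; apply: locq_eq1. Qed.

Lemma locq_scaleE (p : int) q x d : (0 < q)%N -> (0 < d)%N ->
  locq_scale (p%:~R / q%:R) (locq x d) = locq (x *~ p) (q * d).
Proof.
move=> q0 d0; have [k k0] := repr_locq x d0; rewrite /locq_scale.
move: (repr _) => [x' d'] /= eqx; set a := _ / _.
have den0 : (0 < `|denq a|)%N by rewrite absz_gt0 denq_neq0.
have e1 : (numq a * q%:Z = p * `|denq a|%:Z)%R.
  apply: (@intr_inj rat); rewrite absz_denq !intrM.
  have : a = (numq a)%:~R / (denq a)%:~R by rewrite divq_num_den.
  have dn0 : (denq a)%:~R != 0 :> rat by rewrite intr_eq0 denq_neq0.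
  have qn0 : q%:R != 0 :> rat by rewrite pnatr_eq0 -lt0n.
  by move/eqP; rewrite {1}/a eqr_div // -pmulrn => /eqP ->; rewrite mulrC.
apply/locqP; rewrite ?muln_gt0 ?q0 ?den0 //; exists k => //.
have eqx' : x' *~ (d * k)%N = x *~ (d'.+1 * k)%N by rewrite -!pmulrn.
rewrite !pmulrn -!mulrzA !PoszM.
have -> : (numq a * (q%:Z * d%:Z * k%:Z) = d%:Z * k%:Z * (numq a * q%:Z))%R by ring.
rewrite e1 mulrzA -PoszM eqx' -mulrzA; congr (_ *~ _); rewrite !PoszM; ring.
Qed.

Lemma rat_fracP (a : rat) : exists (p : int) (q : nat), (0 < q)%N /\ a = p%:~R / q%:R.
Proof.
exists (numq a), `|denq a|%N; rewrite absz_gt0 denq_neq0; split=> //.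
by rewrite pmulrn absz_denq divq_num_den.
Qed.

Fact locq_addA : associative locq_add.
Proof.
move=> u v w; have [x [d [d0 ->]]] := locq_surj u.
have [y [e [e0 ->]]] := locq_surj v; have [z [f [f0 ->]]] := locq_surj w.
rewrite !locq_addE ?muln_gt0 ?d0 ?e0 //.
apply: locq_eq1; rewrite ?muln_gt0 ?d0 ?e0 ?f0 // mulnA; congr (_ *+ _).
rewrite !mulrnDl -!mulrnA addrA; congr (_ + _ + _); congr (_ *+ _); ring.
Qed.
Fact locq_addC : commutative locq_add.
Proof.
move=> u v; have [x [d [d0 ->]]] := locq_surj u.
by have [y [e [e0 ->]]] := locq_surj v; rewrite !locq_addE // addrC mulnC.
Qed.
Fact locq_add0 : left_id (locq 0 1) locq_add.
Proof.
move=> u; have [x [d [d0 ->]]] := locq_surj u.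
by rewrite locq_addE // mul0rn add0r mul1n.
Qed.
Fact locq_addN : left_inverse (locq 0 1) locq_opp locq_add.
Proof.
move=> u; have [x [d [d0 ->]]] := locq_surj u.
rewrite locq_oppE // locq_addE // mulNrn addNr.
by apply: locq_eq1; rewrite ?muln_gt0 ?d0 // !mul0rn.
Qed.
HB.instance Definition _ := GRing.isZmodule.Build tensQ locq_addA locq_addC locq_add0 locq_addN.

Lemma locqD x y d e : (0 < d)%N -> (0 < e)%N ->
  locq x d + locq y e = locq (x *+ e + y *+ d) (d * e).
Proof. exact: locq_addE. Qed.

Fact locq_scaleA a b u : locq_scale a (locq_scale b u) = locq_scale (a * b) u.
Proof.
have [x [d [d0 ->]]] := locq_surj u.
have [p [q [q0 ->]]] := rat_fracP a; have [r [s [s0 ->]]] := rat_fracP b.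
rewrite mulf_div -intrM -natrM !locq_scaleE ?muln_gt0 ?q0 ?s0 //.
by rewrite -mulrzA mulnA [r * p]mulrC.
Qed.
Fact locq_scale1 : left_id 1 locq_scale.
Proof.
move=> u; have [x [d [d0 ->]]] := locq_surj u.
have -> : 1 = 1%:~R / 1%:R :> rat by rewrite divr1.
by rewrite locq_scaleE // mul1n mulr1z.
Qed.
Fact locq_scaleDr : right_distributive locq_scale +%R.
Proof.
move=> a u v; have [x [d [d0 ->]]] := locq_surj u.
have [y [e [e0 ->]]] := locq_surj v; have [p [q [q0 ->]]] := rat_fracP a.
rewrite locqD // !locq_scaleE ?muln_gt0 ?d0 ?e0 // locqD ?muln_gt0 ?q0 //.
apply: locq_eqz; rewrite ?muln_gt0 ?q0 ?d0 ?e0 //.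
by rewrite !pmulrn !mulrzDl -!mulrzA !PoszM; congr (_ *~ _ + _ *~ _); ring.
Qed.
Fact locq_scaleDl u : {morph locq_scale^~ u : a b / a + b}.
Proof.
move=> a b; have [x [d [d0 ->]]] := locq_surj u.
have [p [q [q0 ->]]] := rat_fracP a; have [r [s [s0 ->]]] := rat_fracP b.
have -> : p%:~R / q%:R + r%:~R / s%:R = (p * s + r * q)%:~R / (q * s)%:R :> rat.
  by rewrite addf_div ?pnatr_eq0 -?lt0n // intrD !intrM natrM -!pmulrn.
rewrite !locq_scaleE ?muln_gt0 ?q0 ?s0 // locqD ?muln_gt0 ?q0 ?s0 //.
apply: locq_eqz; rewrite ?muln_gt0 ?q0 ?d0 ?s0 //.
by rewrite !pmulrn !mulrzDl -!mulrzA -!mulrzDr !PoszM; congr (_ *~ _); ring.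
Qed.
HB.instance Definition _ :=
  GRing.Zmodule_isLmodule.Build rat tensQ locq_scaleA locq_scale1 locq_scaleDr locq_scaleDl.

Lemma locqZ (p : int) q x d : (0 < q)%N -> (0 < d)%N ->
  (p%:~R / q%:R : rat) *: locq x d = locq (x *~ p) (q * d).
Proof. exact: locq_scaleE. Qed.

(* the pure tensor a (x) x *)
Definition pure (a : rat) (x : G) : tensQ := a *: locq x 1.

Lemma pureDl x : {morph pure^~ x : a b / a + b}.
Proof. by move=> a b; rewrite /pure scalerDl. Qed.

Lemma pureDr a : {morph pure a : x y / x + y}.
Proof. by move=> x y; rewrite /pure -scalerDr locqD // !mulr1n. Qed.

Lemma locq_pure x d : (0 < d)%N -> locq x d = pure d%:R^-1 x.
Proof.
move=> d0; rewrite /pure -[d%:R^-1]mul1r -[1]/(1%:~R : rat) locqZ //.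
by rewrite mulr1z muln1.
Qed.

Lemma tensQ_universal (H : zmodType) (b : rat -> G -> H) :
    (forall x, {morph b^~ x : a c / a + c}) -> (forall a, {morph b a : x y / x + y}) ->
  exists h : {additive tensQ -> H}, (forall a x, h (pure a x) = b a x) /\
    forall h' : {additive tensQ -> H}, (forall a x, h' (pure a x) = b a x) -> h' =1 h.
Proof.
move=> bDl bDr.
have b0l x : b 0 x = 0 by apply: (addrI (b 0 x)); rewrite -bDl !addr0.
have b0r a : b a 0 = 0 by apply: (addrI (b a 0)); rewrite -bDr !addr0.
have bNl a x : b (- a) x = - b a x by apply: (addrI (b a x)); rewrite -bDl !subrr.
have bNr a x : b a (- x) = - b a x by apply: (addrI (b a x)); rewrite -bDr !subrr.
have bMn a x n : b a (x *+ n) = b (a *+ n) x.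
  by elim: n => [|n IH]; rewrite ?mulr0n ?b0l ?b0r // !mulrS bDr bDl IH.
have bMz a x (n : int) : b a (x *~ n) = b (a *~ n) x.
  by case: n => n; [exact: bMn | rewrite NegzE !mulrNz bNl bNr; congr (- _); exact: bMn].
pose h (u : tensQ) := b (repr u).2.+1%:R^-1 (repr u).1.
have hfrac x d : (0 < d)%N -> h (locq x d) = b d%:R^-1 x.
  move=> d0; have [k k0] := repr_locq x d0; rewrite /h.
  move: (repr _) => [y m] /=; move: (m.+1) (ltn0Sn m) => n n0 e.
  have -> : n%:R^-1 = (n * d * k)%:R^-1 *+ (d * k) :> rat.
    by rewrite -[RHS]mulr_natr !natrM; field; rewrite !pnatr_eq0 -!lt0n k0 d0 n0.
  rewrite -bMn e bMn; congr b.
  by rewrite -[LHS]mulr_natr !natrM; field; rewrite !pnatr_eq0 -!lt0n k0 d0 n0.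
have hB : zmod_morphism h.
  move=> u v; have [x [d [d0 ->]]] := locq_surj u.
  have [y [e [e0 ->]]] := locq_surj v.
  rewrite -[- locq y e]/(locq_opp (locq y e)) locq_oppE // locqD // !hfrac ?muln_gt0 ?d0 //.
  rewrite bDr !bMn -bNr; congr (b _ _ + b _ _); rewrite -[LHS]mulr_natr natrM;
    by field; rewrite !pnatr_eq0 -!lt0n d0 e0.
pose hM := GRing.isZmodMorphism.Build _ _ h hB.
pose hA : {additive tensQ -> H} := HB.pack h hM.
exists hA; split=> [a x|h' hh' u].
  have [p [q [q0 ->]]] := rat_fracP a; rewrite /pure locqZ // muln1 /= hfrac // bMz.
  by rewrite -[_ *~ p]mulrzl.
by have [x [d [d0 ->]]] := locq_surj u; rewrite /= hfrac // locq_pure.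
Qed.
End TensQ.

(* r_0(G) = n, i.e. Q (x) G has dimension n over Q *)
Definition r0_eq (G : zmodType) (n : nat) : Prop :=
  exists f : {linear tensQ G -> 'rV[rat]_n}, bijective f.

Definition finite_r0 (G : zmodType) : Prop := exists n, r0_eq G n.

Definition class_S (G : zmodType) : Prop := self_small G /\ finite_r0 G.

Definition class_Sstar (G : zmodType) : Prop :=
  [/\ class_S G, reduced G & no_free_summand G].

Definition class_G (A : zmodType) : Prop := class_S A /\ divisible {quot tors A}.

Definition full_free (A : zmodType) (F : zmodClosed A) : Prop :=
  free_group (subg F) /\ torsion_group {quot F}.

Definition quotient_divisible (A : zmodType) : Prop :=
  [/\ finite_r0 A, reduced (subg (tors A)) &
      exists F : zmodClosed A, full_free F /\ divisible {quot F}].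

Definition is_pushout (A B C D : zmodType) (f : {additive A -> B})
    (g : {additive A -> C}) (h : {additive B -> D}) (k : {additive C -> D}) : Prop :=
  (forall a, h (f a) = k (g a)) /\
  forall (E : zmodType) (u : {additive B -> E}) (v : {additive C -> E}),
    (forall a, u (f a) = v (g a)) ->
    exists w : {additive D -> E},
      [/\ forall b, w (h b) = u b, forall c, w (k c) = v c &
          forall w' : {additive D -> E},
            (forall b, w' (h b) = u b) -> (forall c, w' (k c) = v c) -> w' =1 w].

Definition pushout_presentation (G : zmodType) (F L K : zmodClosed G) : Prop :=
  (exists (sFL : {subset F <= L}) (sFK : {subset F <= K}),
     is_pushout (inclg sFK) (inclg sFL) (val : subg K -> G) (val : subg L -> G)) /\
  [/\ full_free F /\
        (forall p, prime p -> ~ trivialg (tors_p G p) -> pdivisible {quot F} p),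
      [/\ quotient_divisible (subg L), {subset tors G <= L} & divisible (quotg L F)],
      torsion_free (subg K) /\ reduced (quotg K F) &
      forall p, prime p -> trivialg (tors_p {quot L} p) \/ trivialg (tors_p G p)].

Definition cancellation (G : zmodType) : Prop :=
  forall A B : zmodType, isog (G * A)%type (G * B)%type -> isog A B.

(* Rings are [pzRingType]s: End(0) is the zero ring. *)

Definition is_unit (R : pzRingType) (u : R) : Prop := exists v, u * v = 1 /\ v * u = 1.

HB.mixin Record isTwoSidedIdeal (R : pzRingType) (I : R -> bool) := {
  ideal_mull : forall a x, x \in I -> a * x \in I;
  ideal_mulr : forall a x, x \in I -> x * a \in I
}.
#[short(type="twoSidedIdeal")]
HB.structure Definition TwoSidedIdeal (R : pzRingType) :=
  {I of GRing.ZmodClosed R I & isTwoSidedIdeal R I}.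

Section RingQuot.
Variables (R : pzRingType) (I : twoSidedIdeal R).

Definition ring_quot : Type := {quot I}.
HB.instance Definition _ := GRing.Zmodule.on ring_quot.
HB.instance Definition _ := EqQuotient.on ring_quot.

Definition rq_one : ring_quot := \pi_ring_quot (1 : R).
Definition rq_mul (u v : ring_quot) : ring_quot :=
  \pi_ring_quot ((repr u : R) * (repr v : R)).

Lemma rq_eqP (x y : R) : reflect (\pi_ring_quot x = \pi_ring_quot y) (x - y \in I).
Proof. by rewrite idealrBE; apply: eqP. Qed.

Lemma rq_mulE (x y : R) : rq_mul (\pi x) (\pi y) = \pi_ring_quot (x * y).
Proof.
rewrite /rq_mul; set x' : R := repr _; set y' : R := repr _.
have xI : x' - x \in I by apply/rq_eqP; rewrite reprK.
have yI : y' - y \in I by apply/rq_eqP; rewrite reprK.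
apply/rq_eqP; have -> : x' * y' - x * y = (x' - x) * y' + x * (y' - y).
  by rewrite mulrBl mulrBr addrA subrK.
by apply: rpredD; [apply: ideal_mulr | apply: ideal_mull].
Qed.

Lemma rq_addE (x y : R) : \pi_ring_quot x + \pi_ring_quot y = \pi_ring_quot (x + y).
Proof. by symmetry; apply: (Quotient.pi_add I x y). Qed.

Lemma rq_surj (u : ring_quot) : exists x : R, u = \pi_ring_quot x.
Proof. by exists (repr u); rewrite reprK. Qed.

Fact rq_mulA : associative rq_mul.
Proof.
move=> u v w; have [x ->] := rq_surj u; have [y ->] := rq_surj v.
have [z ->] := rq_surj w.
by rewrite (rq_mulE y z) (rq_mulE x (y * z)) (rq_mulE x y) (rq_mulE (x * y) z) mulrA.
Qed.
Fact rq_mul1l : left_id rq_one rq_mul.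
Proof. by move=> u; have [x ->] := rq_surj u; rewrite rq_mulE mul1r. Qed.
Fact rq_mul1r : right_id rq_one rq_mul.
Proof. by move=> u; have [x ->] := rq_surj u; rewrite rq_mulE mulr1. Qed.
Fact rq_mulDl : left_distributive rq_mul +%R.
Proof.
move=> u v w; have [x ->] := rq_surj u; have [y ->] := rq_surj v.
have [z ->] := rq_surj w.
by rewrite rq_addE (rq_mulE (x + y) z) (rq_mulE x z) (rq_mulE y z) rq_addE mulrDl.
Qed.
Fact rq_mulDr : right_distributive rq_mul +%R.
Proof.
move=> u v w; have [x ->] := rq_surj u; have [y ->] := rq_surj v.
have [z ->] := rq_surj w.
by rewrite rq_addE (rq_mulE x (y + z)) (rq_mulE x y) (rq_mulE x z) rq_addE mulrDr.
Qed.
HB.instance Definition _ := GRing.Zmodule_isPzRing.Build ring_quot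
  rq_mulA rq_mul1l rq_mul1r rq_mulDl rq_mulDr.
End RingQuot.

Section MultipleIdeal.
Variables (R : pzRingType) (n : nat).

Definition nmul_ideal : {pred R} := [pred x | `[< exists y, x = y *+ n >]].

Fact nmul_ideal_closed : zmod_closed nmul_ideal.
Proof.
split=> [|x y /asboolP[x' ->] /asboolP[y' ->]]; apply/asboolP.
  by exists 0; rewrite mul0rn.
by exists (x' - y'); rewrite mulrnBl.
Qed.
Fact nmul_ideal_mull a x : x \in nmul_ideal -> a * x \in nmul_ideal.
Proof. by move=> /asboolP[y ->]; apply/asboolP; exists (a * y); rewrite mulrnAr. Qed.
Fact nmul_ideal_mulr a x : x \in nmul_ideal -> x * a \in nmul_ideal.
Proof. by move=> /asboolP[y ->]; apply/asboolP; exists (y * a); rewrite mulrnAl. Qed.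
HB.instance Definition _ := GRing.isZmodClosed.Build R nmul_ideal nmul_ideal_closed.
HB.instance Definition _ :=
  isTwoSidedIdeal.Build R nmul_ideal nmul_ideal_mull nmul_ideal_mulr.
End MultipleIdeal.
Arguments nmul_ideal R n : clear implicits.

Definition unit_lifting (R : pzRingType) : Prop :=
  forall n, (0 < n)%N -> forall u : ring_quot (nmul_ideal R n), is_unit u ->
  exists v : R, is_unit v /\ \pi_(ring_quot (nmul_ideal R n)) v = u.

Section Endo.
Variable G : zmodType.

Definition endo : Type := {additive G -> G}.
HB.instance Definition _ := GRing.Zmodule.on endo.

Definition endo_one : endo := idfun.
Definition endo_mul (f g : endo) : endo := f \o g.

Fact endo_mulA : associative endo_mul.
Proof. by move=> f g h; apply: hom_ext. Qed.
Fact endo_mul1l : left_id endo_one endo_mul.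
Proof. by move=> f; apply: hom_ext. Qed.
Fact endo_mul1r : right_id endo_one endo_mul.
Proof. by move=> f; apply: hom_ext. Qed.
Fact endo_mulDl : left_distributive endo_mul +%R.
Proof. by move=> f g h; apply: hom_ext. Qed.
Fact endo_mulDr : right_distributive endo_mul +%R.
Proof. by move=> f g h; apply: hom_ext => x /=; rewrite raddfD. Qed.
HB.instance Definition _ := GRing.Zmodule_isPzRing.Build endo
  endo_mulA endo_mul1l endo_mul1r endo_mulDl endo_mulDr.

(* Hom(G, T(G)), as endomorphisms with image in T(G) *)
Definition hom_tors : {pred endo} :=
  [pred f : endo | `[< forall x, (f : {additive G -> G}) x \in tors G >]].

Fact hom_tors_closed : zmod_closed hom_tors.
Proof.
split=> [|f g /asboolP fT /asboolP gT]; apply/asboolP => x; first exact: rpred0.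
by rewrite [_ x](_ : _ = f x - g x) // rpredB.
Qed.
Fact hom_tors_mull (a f : endo) : f \in hom_tors -> a * f \in hom_tors.
Proof.
move=> /asboolP fT; apply/asboolP => x; have /asboolP[n [n0 e]] := fT x.
by apply/asboolP; exists n; split=> //=; rewrite -raddfMn e raddf0.
Qed.
Fact hom_tors_mulr (a f : endo) : f \in hom_tors -> f * a \in hom_tors.
Proof. by move=> /asboolP fT; apply/asboolP => x; apply: fT. Qed.
HB.instance Definition _ := GRing.isZmodClosed.Build endo hom_tors hom_tors_closed.
HB.instance Definition _ :=
  isTwoSidedIdeal.Build endo hom_tors hom_tors_mull hom_tors_mulr.

Definition EndW : pzRingType := ring_quot hom_tors.
End Endo.

(* Main.v *)
Require Import Defs.
From HB Require Import structures.
From mathcomp Require Import all_boot all_order all_algebra.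
From mathcomp Require Import generic_quotient ring_quotient.
From mathcomp Require Import boolp classical_sets functions cardinality.
From mathcomp Require Import ring zify.
Set Implicit Arguments.
Unset Strict Implicit.
Unset Printing Implicit Defensive.

Import Order.TTheory GRing.Theory Num.Theory Quotient.
Local Open Scope ring_scope.
Local Open Scope quotient_scope.

(** Let [u] be a unit of [EndW G / n], represented by [phi], with inverse [psi].
    Put [T = T(G)] and [N = n^K G + T]; the classes still invert each other modulo
    [N].  Choose a torsion-free group [C] with a surjection [th : C -> G / N] such
    that [Hom(G, C) = 0], every map [C -> G] has its image in [n^J G + T] for all
    [J], and [Aut C = {1, -1}].  The pullbacks [A] of [th] along [G -> G / N] and
    [B] of [th] along [phi : G -> G / N] satisfy [G + A ~ G + B] by Whitehead's
    lemma, so [A ~ B] by cancellation.  Since [Hom(N, C) = 0], this isomorphism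
    restricts to an automorphism of [N], and it induces [1] or [-1] on [C]; as
    maps [C -> G] are negligible, dividing the automorphism of [N] by [n^K] gives a
    unit of [EndW G] congruent to [phi] modulo [n], up to sign.  The division makes
    sense because the [n]-primary torsion of [G] is bounded: [V] is finite, and
    [L = F + p L] with [F] of finite rank makes [T_p(G') / p T_p(G')] finite, so that
    [p^e T_p(G')] is divisible, hence zero, for some [e].

    [C] is a subgroup of [Q^(m+1)] containing [Z^(m+1)] in which the moment curve
    point [(1, t, ..., t^m)] at an [n]-adic integer [t] becomes [n]-divisible.  If
    [t] avoids countably many conditions, proper rational subspaces of [Q^(m+1)]
    meet [C] in free groups, which have no nonzero images of [G] because [G] has no free
    summand, and a map from [C] to [G / T] sends each basis vector to an
    [n]-divisible element by a Vandermonde argument. *)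

Lemma subrACB (A : zmodType) (x y z t : A) : x - y - (z - t) = x - z - (y - t).
Proof. by rewrite !opprB [t - z]addrC addrACA [- y + _]addrC. Qed.

Lemma quotP (G : zmodType) (N : zmodClosed G) (x y : G) :
  x - y \in N <-> \pi_({quot N}) x = \pi_({quot N}) y.
Proof. by rewrite Quotient.idealrBE; split=> /eqP. Qed.

Lemma quot_surj (G : zmodType) (N : zmodClosed G) (u : {quot N}) : exists x, \pi_({quot N}) x = u.
Proof. by exists (repr u); rewrite reprK. Qed.

(** * Divisibility in torsion-free groups *)

(** A polynomial with coefficient list [g]. When [g] lists the images of the basis vectors, its
    value is the image of the moment curve point at [t]. *)
Definition evalz (H : zmodType) (g : seq H) (t : int) : H :=
  \sum_(i < size g) g`_i *~ t ^+ i.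

(** The quotient must lie in [Y]: one ambient group used later contains a rational vector space,
    where divisibility says nothing. *)
Definition qdiv (H : zmodType) (Y : {pred H}) (m : nat) (h : H) : Prop :=
  exists2 y, y \in Y & h = y *+ m.

Section Divisibility.
Variables (H : zmodType) (Y : zmodClosed H).
Hypothesis Htf : torsion_free H.

Lemma mulrn_tf (x y : H) (m : nat) : (0 < m)%N -> x *+ m = y *+ m -> x = y.
Proof.
move=> m0 e; apply/eqP; rewrite -subr_eq0; apply/eqP/Htf/asboolP.
by exists m; split=> //; rewrite mulrnBl e subrr.
Qed.

Lemma qdivB m h1 h2 : qdiv Y m h1 -> qdiv Y m h2 -> qdiv Y m (h1 - h2).
Proof.
by move=> [y1 Y1 ->] [y2 Y2 ->]; exists (y1 - y2); rewrite ?rpredB ?mulrnBl.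
Qed.

Lemma qdivD m h1 h2 : qdiv Y m h1 -> qdiv Y m h2 -> qdiv Y m (h1 + h2).
Proof.
by move=> [y1 Y1 ->] [y2 Y2 ->]; exists (y1 + y2); rewrite ?rpredD ?mulrnDl.
Qed.

Lemma rpredMz (x : H) (c : int) : x \in Y -> x *~ c \in Y.
Proof. by case: c => c xY; rewrite ?NegzE ?mulrNz ?rpredN -?pmulrn rpredMn. Qed.

Lemma qdivMz m h c : qdiv Y m h -> qdiv Y m (h *~ c).
Proof.
move=> [y yY ->]; exists (y *~ c); first exact: rpredMz.
by rewrite !pmulrn -!mulrzA mulrC.
Qed.

Lemma qdiv0 m : qdiv Y m 0.
Proof. by exists 0; rewrite ?rpred0 ?mul0rn. Qed.

Lemma qdiv_sum m I (r : seq I) (P : pred I) (F : I -> H) :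
  (forall i, P i -> qdiv Y m (F i)) -> qdiv Y m (\sum_(i <- r | P i) F i).
Proof. by move=> hF; elim/big_rec: _ => [|i h Pi hh]; [exact: qdiv0|apply: qdivD; auto]. Qed.

Lemma qdiv_dvd m m' h : (m %| m')%N -> qdiv Y m' h -> qdiv Y m h.
Proof.
move=> /dvdnP[k ->] [y yY ->]; exists (y *+ k); first exact: rpredMn.
by rewrite -mulrnA.
Qed.

Lemma qdiv_coprime m k h : coprime m k -> h \in Y -> qdiv Y m (h *+ k) -> qdiv Y m h.
Proof.
move=> co hY [y yY e].
have [u [v uv]] : exists u v : int, u * m%:Z + v * k%:Z = 1.
  by exists (egcdz m k).1, (egcdz m k).2; case: egcdzP => u v -> _; rewrite /gcdz /= (eqP co).
exists (h *~ u + y *~ v); first by rewrite rpredD ?rpredMz.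
have eZ : h *~ k%:Z = y *~ m%:Z by rewrite -!pmulrn.
rewrite -[LHS]mulr1z -uv mulrzDr pmulrn mulrzDl -!mulrzA; congr (_ + _).
have -> : (v * k = k%:Z * v)%R by exact: mulrC.
by rewrite mulrzA eZ -mulrzA [v * m]mulrC.
Qed.

(** Write [c = c' q^a] with [c'] prime to [q]. Divisibility by [q^(k + a)] leaves [q^k] once [q^a]
    is cancelled, and a Bezout relation removes [c']. *)
Lemma qdiv_pure q h c : prime q -> (0 < c)%N -> h \in Y ->
  (forall k, qdiv Y (q ^ k) (h *+ c)) -> forall k, qdiv Y (q ^ k) h.
Proof.
move=> qp c0 hY hd k.
have [c' qc' def_c] := pfactor_coprime qp c0; set a := logn q c in def_c.
have [y yY e] := hd (k + a)%N.
apply: (@qdiv_coprime _ c') => //; first by rewrite coprimeXl.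
exists y => //; apply: (@mulrn_tf _ _ (q ^ a)); first by rewrite expn_gt0 prime_gt0.
by rewrite -!mulrnA -expnD -def_c.
Qed.

Lemma qdiv_purez q h (c : int) : prime q -> c != 0 -> h \in Y ->
  (forall k, qdiv Y (q ^ k) (h *~ c)) -> forall k, qdiv Y (q ^ k) h.
Proof.
move=> qp c0 hY hd; apply: (@qdiv_pure q h `|c|%N) => // [|k]; first by rewrite absz_gt0.
have := hd k; case: c {c0 hd} => c //; rewrite NegzE mulrNz => /(qdivMz (-1)).
by rewrite mulrN1z opprK.
Qed.

Lemma qdiv_smooth (n m : nat) h : (0 < m)%N -> {subset primes m <= primes n} ->
  h \in Y ->
  (forall q k, prime q -> (q %| n)%N -> qdiv Y (q ^ k) h) -> qdiv Y m h.
Proof.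
elim/ltn_ind: m h => m IH h m0 sub hY hd.
have [m1|m1] := leqP m 1.
  by exists h => //; have -> : m = 1%N by lia.
have qp := pdiv_prime m1; have qm := pdiv_dvd m; set q := pdiv m in qp qm.
have qn : (q %| n)%N.
  have /sub : q \in primes m by rewrite mem_primes qp m0.
  by rewrite mem_primes => /and3P[].
have [y yY ey] := hd q 1%N qp qn; rewrite expn1 in ey.
have q0 := prime_gt0 qp.
have e : (m = m %/ q * q)%N by rewrite divnK.
have m'0 : (0 < m %/ q)%N by rewrite divn_gt0 // dvdn_leq.
have [||||z zY ez] := IH (m %/ q)%N _ y _ _ yY => //.
- by rewrite ltn_Pdiv ?prime_gt1.
- move=> p; rewrite mem_primes => /and3P[pp _ pm]; apply: sub.
  by rewrite mem_primes pp m0 e dvdn_mulr.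
- move=> p k pp pn; move: k; apply: (@qdiv_pure p y q) => // k.
  by rewrite -ey; apply: hd.
by exists z => //; rewrite ey ez -mulrnA -e.
Qed.

(** Cramer's rule: the adjugate of the Vandermonde matrix recovers each coefficient, times the
    determinant, from the values at the points. *)
Lemma evalz_det d (g : 'I_d -> H) (t : 'I_d -> int) m :
  (forall a, qdiv Y m (\sum_(i < d) g i *~ t a ^+ i)) ->
  forall i, qdiv Y m (g i *~ \prod_(a < d) \prod_(b < d | (a < b)%N) (t b - t a)).
Proof.
move=> hd i; pose A : 'M[int]_d := Vandermonde d (\row_a t a).
have -> : \prod_(a < d) \prod_(b < d | (a < b)%N) (t b - t a) = \det A.
  by rewrite det_Vandermonde; do 2! (apply: eq_bigr => ? _); rewrite !mxE.
have -> : g i *~ \det A =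
    \sum_a (\sum_(j < d) g j *~ t a ^+ j) *~ (\adj A a i).
  under eq_bigr do rewrite mulrz_suml.
  rewrite exchange_big /= (bigD1 i) //= [X in _ + X]big1 ?addr0 => [|j ji].
    under eq_bigr do rewrite -mulrzA.
    rewrite -mulrz_sumr; congr (_ *~ _).
    have /matrixP/(_ i i) := mul_mx_adj A; rewrite !mxE eqxx mulr1n => <-.
    by apply: eq_bigr => a _; rewrite !mxE.
  under eq_bigr do rewrite -mulrzA.
  rewrite -mulrz_sumr.
  have /matrixP/(_ j i) := mul_mx_adj A; rewrite !mxE (negPf ji) mulr0n => e.
  rewrite (_ : \sum_a _ = 0) ?mulr0z // -[RHS]e.
  by apply: eq_bigr => a _; rewrite !mxE.
by apply: qdiv_sum => a _; apply: qdivMz.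
Qed.
End Divisibility.

(** * A generic n-adic integer *)

Lemma dvdz_expn (n k l : nat) : (k <= l)%N -> ((n ^ k)%N %| (n ^ l)%N%:Z)%Z.
Proof. by move=> kl; rewrite dvdzE !absz_nat dvdn_exp2l. Qed.

Section Generic.
Variables (H : zmodType) (Y : zmodClosed H).
Hypothesis Htf : torsion_free H.

Lemma dvdz_exp_sub (m t t' : int) i : (m %| t - t')%Z -> (m %| t ^+ i - t' ^+ i)%Z.
Proof. by rewrite subrXX; apply: dvdz_mulr. Qed.

Lemma evalz_cong (m : nat) (g : seq H) (t t' : int) :
  {subset g <= Y} -> (m %| t - t')%Z -> qdiv Y m (evalz g t - evalz g t').
Proof.
move=> gY mt; rewrite -sumrB; apply: qdiv_sum => i _.
have /dvdzP[c e] := dvdz_exp_sub i mt.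
rewrite -mulrzBr e; exists (g`_i *~ c); last by rewrite mulrzA pmulrn.
by apply/rpredMz/gY/mem_nth.
Qed.

Variable n : nat.
Hypothesis n1 : (1 < n)%N.

(* Among the integers congruent to [t] modulo [n ^ j] some [t'] has [evalz g t'] not
   infinitely [q]-divisible, unless all of [g] is; this persists modulo [q ^ j']. *)
Lemma generic_step (q : nat) (g : seq H) (t : int) (j : nat) :
  exists (t' : int) (j' : nat), [/\ (j < j')%N, ((n ^ j)%N %| t' - t)%Z &
    prime q -> (q %| n)%N -> {subset g <= Y} -> qdiv Y (q ^ j') (evalz g t') ->
    forall x, x \in g -> forall k, qdiv Y (q ^ k) x].
Proof.
have [[qp [qn gY]]|bad] := pselect (prime q /\ (q %| n)%N /\ {subset g <= Y}); last first.
  exists t, j.+1; split=> //; first by rewrite subrr dvdz0.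
  by move=> qp qn gY; case: bad.
pose T (u : nat) : int := t + (n ^ j)%N%:Z * u%:Z.
have Tdvd u : ((n ^ j)%N %| T u - t)%Z by rewrite /T addrC addKr dvdz_mulr.
have [[u [k bad]]|ok] := pselect (exists u k, ~ qdiv Y (q ^ k) (evalz g (T u))).
  exists (T u), (maxn j.+1 k); split=> //; first exact: leq_maxl.
  move=> _ _ _ /(@qdiv_dvd _ _ (q ^ k)) hk; case: bad; apply: hk.
  by rewrite dvdn_exp2l ?leq_maxr.
exists t, j.+1; split=> //; first by rewrite subrr dvdz0.
move=> _ _ _ _ x xg; have [i ig <-] := nthP 0 xg.
(* Here every [evalz g (T u)] is infinitely [q]-divisible. The points [T u] are distinct, so the
   Vandermonde determinant [d] is nonzero and can be cancelled. *)
pose d := \prod_(a < size g) \prod_(b < size g | (a < b)%N) (T b - T a).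
have d0 : d != 0.
  apply/prodf_neq0 => a _; apply/prodf_neq0 => b ab.
  rewrite /T opprD addrACA subrr add0r -mulrBr mulf_neq0 ?subr_eq0 //.
    by rewrite -lt0n expn_gt0 ltnW.
  by rewrite eqz_nat gtn_eqF.
apply: (@qdiv_purez _ Y Htf q _ d) => // [|k]; first exact/gY/mem_nth.
apply: (@evalz_det _ _ _ (fun i => g`_i) (fun a => T a) _ _ (Ordinal ig)) => a.
by apply: contrapT => nq; apply: ok; exists a, k.
Qed.

(** A Baire category argument: tasks are settled one after the other, each by a congruence modulo a
    power of [n] that all later terms respect. *)
Lemma exists_generic (task : nat -> nat * seq H) :
  exists tau : nat -> int, (forall k l, (k <= l)%N -> ((n ^ k)%N %| tau l - tau k)%Z) /\
    forall i, prime (task i).1 -> ((task i).1 %| n)%N -> {subset (task i).2 <= Y} ->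
      (forall k, qdiv Y ((task i).1 ^ k) (evalz (task i).2 (tau k))) ->
      forall x, x \in (task i).2 -> forall k, qdiv Y ((task i).1 ^ k) x.
Proof.
(* In a state [(i, (t, j))], task [i] is next and all later integers agree with [t] modulo
   [n ^ j]. *)
pose P (u v : nat * (int * nat)) := [/\ v.1 = u.1.+1, (u.2.2 < v.2.2)%N,
    ((n ^ u.2.2)%N %| v.2.1 - u.2.1)%Z &
    prime (task u.1).1 -> ((task u.1).1 %| n)%N -> {subset (task u.1).2 <= Y} ->
    qdiv Y ((task u.1).1 ^ v.2.2) (evalz (task u.1).2 v.2.1) ->
    forall x, x \in (task u.1).2 -> forall k, qdiv Y ((task u.1).1 ^ k) x].
have exP u : exists v, P u v.
  case: u => i [t j]; have [t' [j' [h1 h2 h3]]] := generic_step (task i).1 (task i).2 t j.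
  by exists (i.+1, (t', j')).
have [next nextP] := boolp.choice exP.
pose st k := iter k next (0%N, (0, 0%N)).
have st1 k : (st k).1 = k by elim: k => //= k IH; case: (nextP (st k)) => ->; rewrite IH.
have stlt k : ((st k).2.2 < (st k.+1).2.2)%N by case: (nextP (st k)).
have stj k : (k <= (st k).2.2)%N by elim: k => //= k IH; apply: leq_ltn_trans (stlt k).
have stle k l : (k <= l)%N -> ((st k).2.2 <= (st l).2.2)%N.
  move=> /subnK <-; elim: (l - k)%N => // d IH.
  by rewrite addSn; apply: leq_trans IH (ltnW (stlt _)).
have stdvd k l : (k <= l)%N -> ((n ^ (st k).2.2)%N %| (st l).2.1 - (st k).2.1)%Z.
  move=> /subnK <-; elim: (l - k)%N => [|d IH]; first by rewrite subrr dvdz0.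
  rewrite -(subrKA (st (d + k)).2.1) rpredD ?IH //.
  rewrite addSn; case: (nextP (st (d + k))) => _ _ h _; apply: dvdz_trans h.
  by apply: dvdz_expn; rewrite stle ?leq_addl.
exists (fun k => (st k).2.1); split=> [k l kl|i qp qn gY hq].
  by apply: dvdz_trans (stdvd _ _ kl); apply: dvdz_expn.
have [_ _ _] := nextP (st i); rewrite st1; apply=> //.
change (next (st i)) with (st i.+1).
(* The precision fixed when task [i] was settled: term [k] agrees with the integer of that stage
   modulo [n ^ k], hence modulo [q ^ k]. *)
set k := (st i.+1).2.2; have ik : (i.+1 <= k)%N by exact: stj.
rewrite -[evalz _ _](subKr (evalz (task i).2 (st k).2.1)).
apply: qdivB; first exact: hq.
apply: evalz_cong => //; apply: dvdz_trans (stdvd _ _ ik).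
by rewrite dvdzE !absz_nat dvdn_exp2r.
Qed.
End Generic.

(** * A rigid group built on an n-adic moment curve *)

Lemma common_denom (I : finType) (F : I -> rat) :
  exists2 D : nat, (0 < D)%N & forall i, F i * D%:R \is a Num.int.
Proof.
exists (\prod_i `|denq (F i)|)%N; first by apply: prodn_gt0 => i; rewrite absz_gt0 denq_neq0.
move=> i; rewrite (bigD1 i) //= natrM mulrA rpredM ?natr_int //.
rewrite -{1}[F i]divq_num_den pmulrn absz_denq mulrVK ?intr_int //.
by rewrite unitfE intr_eq0 denq_neq0.
Qed.

Lemma dvdz_natexp (n k : nat) (a : int) :
  ((n ^ k)%N %| a)%Z -> (a%:~R / n%:R ^+ k : rat) \is a Num.int.
Proof.
case: n => [|n]; first by case: k => [|k] _; rewrite ?expr0 ?divr1 ?exprS ?mul0r ?invr0 ?mulr0 // intr_int.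
move=> /dvdzP[c ->]; rewrite intrM -pmulrn natrX mulfK ?intr_int //.
by rewrite expf_neq0 // pnatr_eq0.
Qed.

Section Rigid.
Variables (n m : nat) (tau : nat -> int).
Hypothesis n1 : (1 < n)%N.
Hypothesis tau_coh : forall k l, (k <= l)%N -> ((n ^ k)%N %| tau l - tau k)%Z.

Local Notation V := 'rV[rat]_m.+1.

Definition veronese (t : int) : V := \row_i t%:~R ^+ i.

Definition intvec : {pred V} := [pred x : V | [forall i, x 0 i \is a Num.int]].

Lemma intvecP (x : V) : reflect (forall i, x 0 i \is a Num.int) (x \in intvec).
Proof. exact: forallP. Qed.

Fact intvec_closed : zmod_closed intvec.
Proof.
split=> [|x y /intvecP hx /intvecP hy]; apply/intvecP => i; rewrite !mxE ?rpred0 //.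
by rewrite rpredB.
Qed.
HB.instance Definition _ := GRing.isZmodClosed.Build _ intvec intvec_closed.

Lemma intvecZ (c : rat) x : c \is a Num.int -> x \in intvec -> c *: x \in intvec.
Proof. by move=> hc /intvecP hx; apply/intvecP => i; rewrite mxE rpredM. Qed.

Lemma intvec_veronese t : veronese t \in intvec.
Proof. by apply/intvecP => i; rewrite mxE rpredX ?intr_int. Qed.

Lemma expn_neq0 s : (n%:R ^+ s : rat) != 0.
Proof. by rewrite expf_neq0 // pnatr_eq0; lia. Qed.

(* Multiples of the limit point of the moment curve divided by [n ^ s], known modulo
   integral vectors only; [rigid] is generated by these and the integral vectors. *)
Definition approx (s : nat) (a : int) : V := (a%:~R / n%:R ^+ s) *: veronese (tau s).

Lemma approxB s a b : approx s (a - b) = approx s a - approx s b.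
Proof. by rewrite /approx intrB mulrBl scalerBl. Qed.

Lemma approx_shift s s' a : (s <= s')%N ->
  approx s a - approx s' (a * (n ^ (s' - s))%N) \in intvec.
Proof.
move=> ss'; apply/intvecP => i; rewrite !mxE.
have -> : (a * (n ^ (s' - s))%N)%:~R / n%:R ^+ s' = a%:~R / n%:R ^+ s :> rat.
  rewrite intrM -pmulrn natrX -{2}(subnK ss') exprD; field.
  by rewrite !expn_neq0.
have e t : t%:~R ^+ i = (t ^+ i)%:~R :> rat by rewrite rmorphXn.
rewrite -mulrBr mulrAC !e -intrB -intrM; apply: dvdz_natexp.
by apply: dvdz_mull; rewrite -rpredN opprB; apply/dvdz_exp_sub/tau_coh.
Qed.

Definition rigid : {pred V} := [pred x : V | `[< exists s a, x - approx s a \in intvec >]].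

Lemma rigid_ge x s0 : x \in rigid -> exists s a, (s0 <= s)%N /\ x - approx s a \in intvec.
Proof.
move=> /asboolP[s [a h]]; exists (maxn s0 s), (a * (n ^ (maxn s0 s - s))%N).
split; first exact: leq_maxl.
by rewrite -(subrKA (approx s a)) rpredD // approx_shift ?leq_maxr.
Qed.

Fact rigid_closed : zmod_closed rigid.
Proof.
split=> [|x y /asboolP[s [a hx]] /(rigid_ge s)[s' [b [ss' hy]]]]; apply/asboolP.
  by exists 0%N, 0; rewrite /approx mul0r scale0r subr0 rpred0.
exists s', (a * (n ^ (s' - s))%N - b); rewrite approxB.
by rewrite subrACB rpredB // -(subrKA (approx s a)) rpredD ?approx_shift.
Qed.
HB.instance Definition _ := GRing.isZmodClosed.Build _ rigid rigid_closed.

(** For each prime [q] dividing [n], the [q]-adic limit of [tau] is transcendental over the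
    rationals. *)
Hypothesis gen_int : forall q (P : {poly int}), prime q -> (q %| n)%N ->
  (forall k, ((q ^ k)%N %| P.[tau k])%Z) -> P = 0.

Lemma horner_cong (P : {poly int}) (d t t' : int) :
  (d %| t - t')%Z -> (d %| P.[t] - P.[t'])%Z.
Proof.
move=> h; rewrite !horner_coef -sumrB; apply: rpred_sum => i _.
by rewrite -mulrBr; apply/dvdz_mull/dvdz_exp_sub.
Qed.

Lemma dvdz_base (q k : nat) (x : int) : (q %| n)%N -> ((n ^ k)%N %| x)%Z -> ((q ^ k)%N %| x)%Z.
Proof. by move=> qn; apply: dvdz_trans; rewrite dvdzE !absz_nat dvdn_exp2r. Qed.

(** [P] does not vanish at the [q]-adic limit, so some [q^k0] divides no later [P.[tau k]]. The
    largest [k0] over the primes of [n] serves as [b]; for [k < k0] the factor [n^b] alone accounts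
    for the [q]-part. *)
Lemma bounded_valuation (P : {poly int}) : P != 0 ->
  exists b : nat, forall k (a : int),
    ((n ^ k)%N %| a * P.[tau k])%Z -> ((n ^ k)%N %| a * (n ^ b)%N)%Z.
Proof.
move=> P0.
have exk q : exists k0, prime q -> (q %| n)%N -> ~~ ((q ^ k0)%N %| P.[tau k0])%Z.
  have [[qp qn]|nq] := pselect (prime q /\ (q %| n)%N); last by exists 0%N => qp qn; case: nq.
  apply: contrapT => nk; case/negP: P0; apply/eqP/(gen_int qp qn) => k.
  by apply: contrapT => /negP hk; apply: nk; exists k.
have [k0 k0P] := boolp.choice exk.
exists (\max_(q <- primes n) k0 q)%N => k a; set b := (\max_(_ <- _) _)%N => h.
have [->|a0] := eqVneq a 0; first by rewrite mul0r dvdz0.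
have n0 : (0 < n)%N by lia.
rewrite dvdzE abszM !absz_nat; apply/dvdn_partP; first by rewrite expn_gt0 n0.
case: k h => [|k] h q; first by rewrite expn0 /= inE.
rewrite pi_of_exp // => qpi.
have /and3P[qp _ qn] : [&& prime q, (0 < n)%N & (q %| n)%N] by rewrite -mem_primes.
rewrite p_part pfactor_dvdn ?muln_gt0 ?absz_gt0 ?a0 ?expn_gt0 ?n0 //.
rewrite lognM ?absz_gt0 ?a0 ?expn_gt0 ?n0 // !lognX.
have v1 : (0 < logn q n)%N by rewrite logn_gt0.
have kb : (k0 q <= b)%N by apply: leq_bigmax_seq.
have [kk|kk] := leqP (k0 q) k.+1; last by nia.
have nd : ~~ ((q ^ k0 q)%N %| P.[tau k.+1])%Z.
  apply: contra (k0P q qp qn) => hd.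
  rewrite -[P.[tau (k0 q)]](subKr P.[tau k.+1]) rpredB //.
  by apply: (dvdz_base qn); apply/horner_cong/tau_coh.
have p0 : P.[tau k.+1] != 0 by apply: contraNneq nd => ->; rewrite dvdz0.
have := nd; rewrite dvdzE absz_nat pfactor_dvdn ?absz_gt0 // -ltnNge => vP.
move: h; rewrite dvdzE abszM absz_nat => /(dvdn_leq_log q).
rewrite muln_gt0 !absz_gt0 a0 p0 => /(_ isT).
by rewrite lognM ?absz_gt0 ?a0 ?p0 // lognX; nia.
Qed.

(** The linear form with the coefficients of [P], so that rational hyperplanes are encoded by
    integer polynomials. *)
Definition coords (x : V) (P : {poly int}) : rat := \sum_(i < m.+1) x 0 i * (P`_i)%:~R.

Lemma coords_veronese t (P : {poly int}) : (size P <= m.+1)%N ->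
  coords (veronese t) P = P.[t]%:~R.
Proof.
move=> sP; rewrite (horner_coef_wide _ sP) rmorph_sum; apply: eq_bigr => i _.
by rewrite mxE mulrC rmorphM rmorphXn.
Qed.

Lemma coords_intvec x (P : {poly int}) : x \in intvec -> coords x P \is a Num.int.
Proof. by move=> /intvecP hx; apply: rpred_sum => i _; rewrite rpredM ?intr_int. Qed.

Lemma coordsDZ (x y : V) c (P : {poly int}) : coords (x + c *: y) P = coords x P + c * coords y P.
Proof.
rewrite /coords mulr_sumr -big_split; apply: eq_bigr => i _.
by rewrite !mxE mulrDl mulrA.
Qed.

(** In a hyperplane the [n]-divisible direction occurs only with denominators dividing [n^b], by
    [bounded_valuation]. So [n^b] carries the image into the integral vectors, whose coordinates are
    maps from [G] to the integers. *)
Lemma hom_to_rigid (G : zmodType) (f : {additive G -> subg rigid}) (P : {poly int}) :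
  (forall g : {additive G -> int}, forall x, g x = 0) ->
  P != 0 -> (size P <= m.+1)%N -> (forall x, coords (val (f x)) P = 0) ->
  forall x, f x = 0.
Proof.
move=> G0 P0 sP fP; have [b hb] := bounded_valuation P0.
have fint x : (n ^ b)%:R *: val (f x) \in intvec.
  have /asboolP[s [a ha]] := valP (f x).
  have e : val (f x) = (val (f x) - approx s a) + (a%:~R / n%:R ^+ s) *: veronese (tau s).
    by rewrite subrK.
  have := fP x; rewrite e coordsDZ coords_veronese // -e.
  have /intrP[c ->] := coords_intvec P ha => ez.
  have : ((n ^ s)%N %| a * P.[tau s])%Z.
    apply/dvdzP; exists (- c); apply: (@intr_inj rat).
    rewrite !intrM -pmulrn natrX; move/eqP: ez; rewrite addrC addr_eq0 => /eqP ez.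
    by rewrite intrN -ez; field; rewrite expn_neq0.
  move=> /hb hab; rewrite e scalerDr scalerA rpredD //.
    by apply: intvecZ => //; rewrite natr_int.
  apply: intvecZ (intvec_veronese _); have := dvdz_natexp hab.
  by rewrite intrM -pmulrn mulrA [a%:~R * _]mulrC.
move=> x; apply: val_inj; apply/rowP => i; rewrite mxE.
pose g y : int := Num.floor (((n ^ b)%:R *: val (f y)) 0 i).
have gE y : (g y)%:~R = ((n ^ b)%:R *: val (f y)) 0 i.
  by rewrite /g floorK //; apply/intvecP.
have gB : zmod_morphism g.
  move=> y z; apply: (@intr_inj rat); by rewrite intrB !gE raddfB /= !mxE mulrBr.
pose gM := GRing.isZmodMorphism.Build _ _ g gB.
pose gA : {additive G -> int} := HB.pack g gM.
have := gE x; rewrite (G0 gA x : g x = 0) !mxE => /esym/eqP.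
by rewrite mulf_eq0 natrX (negPf (expn_neq0 _)) /= => /eqP.
Qed.

(** * Endomorphisms of the rigid group and maps out of it *)

Lemma intvec_rigid x : x \in intvec -> x \in rigid.
Proof.
by move=> hx; apply/asboolP; exists 0%N, 0; rewrite /approx mul0r scale0r subr0.
Qed.

Definition rigid_of (x : V) (hx : x \in intvec) : subg rigid :=
  exist (fun y => y \in rigid) x (intvec_rigid hx).

Lemma intvec_delta (i : 'I_m.+1) : (delta_mx 0 i : V) \in intvec.
Proof. by apply/intvecP => j; rewrite mxE natr_int. Qed.

Definition basis_rigid (i : 'I_m.+1) : subg rigid := rigid_of (intvec_delta i).

Lemma val_rigidMz (y : subg rigid) c : val (y *~ c) = c%:~R *: val y.
Proof. by rewrite scaler_int raddfMz. Qed.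

Lemma rigid_intvec (x : V) (hx : x \in intvec) :
  rigid_of hx = \sum_i basis_rigid i *~ Num.floor (x 0 i).
Proof.
apply: val_inj; rewrite raddf_sum /= {1}[x]row_sum_delta; apply: eq_bigr => i _.
by rewrite [RHS]val_rigidMz floorK //; apply/intvecP.
Qed.

Lemma rigid_denom (y : subg rigid) : exists s (hx : n%:R ^+ s *: val y \in intvec),
  y *+ (n ^ s) = rigid_of hx.
Proof.
have /asboolP[s [a ha]] := valP y; exists s.
have hx : n%:R ^+ s *: val y \in intvec.
  rewrite -(subrK (approx s a) (val y)) scalerDr rpredD //.
    by rewrite intvecZ // rpredX // natr_int.
  by rewrite scalerA mulrC mulfVK ?expn_neq0 // intvecZ ?intr_int ?intvec_veronese.
by exists hx; apply: val_inj; rewrite raddfMn /= -natrX scaler_nat.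
Qed.

Lemma rigid_tf : torsion_free (subg rigid).
Proof.
move=> y /asboolP[k [k0 e]]; apply: val_inj; have := congr1 val e; rewrite raddfMn /=.
move=> /eqP; rewrite -scaler_nat scaler_eq0 pnatr_eq0 -[k == _]negbK -lt0n k0 /=.
by move/eqP.
Qed.

Lemma approx1_rigid s : approx s 1 \in rigid.
Proof. by apply/asboolP; exists s, 1; rewrite subrr rpred0. Qed.

(** On the moment curve each coordinate of [h] is, up to the denominator [D], a polynomial [P j].
    Preserving the [n]-divisible direction forces [P j = 'X^j * P ord0], and the degree bound makes
    [P ord0] constant. *)
Lemma rigid_scalar (h : {additive subg rigid -> subg rigid}) :
  exists c : rat, forall y, val (h y) = c *: val y.
Proof.
have [D D0 hD] := common_denom (fun ij : 'I_m.+1 * 'I_m.+1 => val (h (basis_rigid ij.1)) 0 ij.2).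
have iX (t : int) k : (t ^+ k)%:~R = t%:~R ^+ k :> rat by rewrite rmorphXn.
have DQ0 : (D%:R : rat) != 0 by rewrite pnatr_eq0 -lt0n.
pose c i j : int := Num.floor (val (h (basis_rigid i)) 0 j * D%:R).
have cE i j : (c i j)%:~R = val (h (basis_rigid i)) 0 j * D%:R by rewrite floorK //; apply: (hD (i, j)).
pose P (j : 'I_m.+1) : {poly int} := \poly_(i < m.+1) c (inord i) j.
have hint x (hx : x \in intvec) : val (h (rigid_of hx)) = \sum_i x 0 i *: val (h (basis_rigid i)).
  rewrite rigid_intvec raddf_sum raddf_sum; apply: eq_bigr => i _.
  by rewrite raddfMz [LHS]val_rigidMz floorK //; apply/intvecP.
have PE t j : val (h (rigid_of (intvec_veronese t))) 0 j * D%:R = (P j).[t]%:~R.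
  rewrite hint summxE mulr_suml horner_poly rmorph_sum; apply: eq_bigr => i _.
  by rewrite !mxE inord_val rmorphM rmorphXn /= cE; ring.
have Pdvd s j : ((n ^ s)%N %| (P j).[tau s] - tau s ^+ j * (P ord0).[tau s])%Z.
  pose y : subg rigid := exist (fun y => y \in rigid) _ (approx1_rigid s).
  have yE : y *+ (n ^ s) = rigid_of (intvec_veronese (tau s)).
    apply: val_inj; rewrite raddfMn /= -scaler_nat /approx scalerA natrX mul1r divff ?scale1r //.
    exact: expn_neq0.
  have [s' [a [ss' hz]]] := rigid_ge s (valP (h y)).
  pose z j := Num.floor ((val (h y) - approx s' a) 0 j).
  have zE k : (P k).[tau s]%:~R = D%:R * n%:R ^+ s * ((z k)%:~R +
      a%:~R / n%:R ^+ s' * (tau s')%:~R ^+ k) :> rat.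
    rewrite -PE -yE !raddfMn /= -scaler_nat natrX floorK; last by apply/intvecP.
    rewrite !mxE subrK; ring.
  (* Coordinate 0 of the moment curve is 1, so [b] is the multiple of [veronese (tau s')] in the
     scaled image; the same [b] governs the other coordinates. *)
  pose b := (P ord0).[tau s] - D%:Z * (n ^ s)%N%:Z * z ord0.
  have bE : b%:~R = D%:R * n%:R ^+ s * (a%:~R / n%:R ^+ s') :> rat.
    by rewrite intrB zE !intrM -!pmulrn natrX expr0; ring.
  have eP k : (P k).[tau s] = D%:Z * (n ^ s)%N%:Z * z k + b * tau s' ^+ k.
    apply: (@intr_inj rat); rewrite zE intrD !intrM bE iX -!pmulrn natrX; ring.
  have -> : (P j).[tau s] - tau s ^+ j * (P ord0).[tau s] =
      (D%:Z * z j - tau s ^+ j * D%:Z * z ord0) * (n ^ s)%N%:Z + b * (tau s' ^+ j - tau s ^+ j).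
    by rewrite !eP expr0; ring.
  by rewrite rpredD ?dvdz_mull //; apply/dvdz_exp_sub/tau_coh.
(* The image of the [n]-divisible direction is [n]-divisible, hence proportional to it. *)
have PX j : P j = 'X^j * P ord0.
  apply/eqP; rewrite -subr_eq0; apply/eqP.
  apply: (gen_int (pdiv_prime n1) (pdiv_dvd n)) => k.
  by rewrite !hornerE; apply: (dvdz_base (pdiv_dvd n)).
(* As [P ord_max = 'X^m * P ord0] has size at most [m.+1], only the constant coefficient of [P ord0]
   survives. *)
have P0 k : (P ord0)`_k.+1 = 0.
  have := congr1 (fun Q : {poly int} => Q`_(m + k.+1)) (PX ord_max).
  by rewrite coefXnM ltnNge leq_addr addKn coef_poly addnS ltnS ltnNge leq_addr /= => <-.
have hb i : val (h (basis_rigid i)) = (((P ord0)`_0)%:~R / D%:R) *: val (basis_rigid i).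
  apply/rowP => j; rewrite !mxE eqxx /=; apply: (mulIf DQ0).
  rewrite -cE -[i in c i j]inord_val.
  have -> : c (inord i) j = (P j)`_i by rewrite coef_poly ltn_ord.
  rewrite PX coefXnM mulrAC mulfVK //.
  case: ltngtP => [ij|ij|ij].
  - by rewrite -val_eqE /= gtn_eqF // mulr0.
  - by rewrite -val_eqE /= ltn_eqF // mulr0 -(subnSK ij) P0.
  - by rewrite (_ : j = i) ?eqxx ?mulr1 ?subnn //; apply: val_inj.
exists (((P ord0)`_0)%:~R / D%:R) => y.
have [s [hx e]] := rigid_denom y.
have : val (h (y *+ (n ^ s))) = (((P ord0)`_0)%:~R / D%:R) *: (n%:R ^+ s *: val y).
  rewrite e hint [in RHS](row_sum_delta (n%:R ^+ s *: val y)) scaler_sumr.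
  by apply: eq_bigr => i _; rewrite hb !scalerA mulrC.
rewrite !raddfMn /= -scaler_nat natrX scalerA mulrC -scalerA.
by move=> /(scalerI (expn_neq0 s)).
Qed.

(** Coordinate 0 shows that [a / n^s] is an integer; coordinate [i] then shows it for [c]. *)
Lemma rigid_scalar_int c (i : 'I_m.+1) : (i != 0%N :> nat) ->
  c *: val (basis_rigid i) \in rigid -> c \is a Num.int.
Proof.
move=> i0 /asboolP[s [a /intvecP ha]].
have := ha ord0; have := ha i; rewrite !mxE !eqxx /= expr0 mulr1 -val_eqE /= eq_sym (negPf i0).
rewrite mulr1 mulr0 sub0r rpredN => hi ha0.
by rewrite -(subrK (a%:~R / n%:R ^+ s * (tau s)%:~R ^+ i) c) rpredD // rpredM // rpredX // intr_int.
Qed.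

Lemma rigid_aut (h : {additive subg rigid -> subg rigid}) : (0 < m)%N -> bijective h ->
  (forall y, h y = y) \/ (forall y, h y = - y).
Proof.
move=> m0 [k hk kh].
have kB : zmod_morphism k.
  by move=> x y; apply: (can_inj hk); rewrite raddfB !kh.
pose kM := GRing.isZmodMorphism.Build _ _ k kB.
pose kA : {additive subg rigid -> subg rigid} := HB.pack k kM.
have [c hc] := rigid_scalar h; have [d hd] := rigid_scalar kA.
have mm : (@ord_max m != 0%N :> nat) by rewrite -lt0n.
have cint : c \is a Num.int.
  by apply: (rigid_scalar_int mm); rewrite -hc; apply: valP.
have dint : d \is a Num.int.
  by apply: (rigid_scalar_int mm); rewrite -hd; apply: valP.
have cd : c * d = 1.
  have := congr1 (fun y : subg rigid => (val y : V) 0 ord_max) (kh (basis_rigid ord_max)).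
  by rewrite hc [in LHS]hd !mxE !eqxx mulr1.
move: cint dint cd => /intrP[c' ec] /intrP[d' ed]; rewrite ec ed -intrM => cd.
have {}cd : c' * d' = 1 by apply: (@intr_inj rat).
have : (c' == 1) || (c' == -1).
  rewrite -[_ || _]/(c' \is a GRing.unit).
  by apply/unitrPr; exists d'.
case/orP=> /eqP e; [left|right] => y; apply: val_inj; rewrite hc ec e.
  by rewrite scale1r.
by rewrite rmorphN scaleN1r raddfN.
Qed.

(** The moment curve point at [tau k] is [n^k] times an element of the group, so genericity applies
    to the images of the basis vectors. Any element becomes an integral combination of these vectors
    after multiplication by a power of [n]. *)
Lemma rigid_hom_divisible (H : zmodType) (Y : zmodClosed H) (h : {additive subg rigid -> H}) :
  torsion_free H -> (forall y, h y \in Y) ->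
  (forall (q : nat) (g : seq H), prime q -> (q %| n)%N -> {subset g <= Y} ->
    (forall k, qdiv Y (q ^ k) (evalz g (tau k))) ->
    forall x, x \in g -> forall k, qdiv Y (q ^ k) x) ->
  forall J y, qdiv Y (n ^ J) (h y).
Proof.
move=> Htf hY gen.
pose g := mkseq (fun i => h (basis_rigid (inord i))) m.+1.
have gi (i : 'I_m.+1) : h (basis_rigid i) \in g.
  by apply/mapP; exists (i : nat); rewrite ?mem_iota ?ltn_ord // inord_val.
have gE t : evalz g t = h (rigid_of (intvec_veronese t)).
  rewrite rigid_intvec raddf_sum /evalz size_mkseq; apply: eq_bigr => i _.
  rewrite nth_mkseq // inord_val raddfMz mxE.
  have -> : t%:~R ^+ i = (t ^+ i)%:~R :> rat by rewrite rmorphXn.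
  by rewrite intrKfloor.
have gY : {subset g <= Y} by move=> x /mapP[i _ ->].
have gdiv q (qp : prime q) (qn : (q %| n)%N) i k : qdiv Y (q ^ k) (h (basis_rigid i)).
  move: (basis_rigid i) (gi i) k => b bg; move: b bg => b bg.
  apply: (gen q g qp qn gY) => // k; rewrite gE.
  pose y : subg rigid := exist (fun y => y \in rigid) _ (approx1_rigid k).
  have <- : y *+ (n ^ k) = rigid_of (intvec_veronese (tau k)).
    apply: val_inj; rewrite raddfMn /= -scaler_nat /approx scalerA natrX mul1r divff ?scale1r //.
    exact: expn_neq0.
  by apply: (@qdiv_dvd _ _ _ (n ^ k)); rewrite ?dvdn_exp2r // raddfMn; exists (h y).
move=> J y; apply: (@qdiv_smooth _ Y Htf n) => //.
- by rewrite expn_gt0; lia.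
- by case: J => [|J] p; [rewrite expn0|rewrite primesX].
move=> q k qp qn; move: k.
have [s [hx e]] := rigid_denom y.
apply: (@qdiv_pure _ Y Htf q _ (n ^ s)) => // [|k]; first by rewrite expn_gt0; lia.
rewrite -raddfMn e rigid_intvec raddf_sum; apply: qdiv_sum => i _.
by rewrite raddfMz; apply/qdivMz/gdiv.
Qed.

(** * Surjection of the rigid group onto [G / N] *)

Section Residue.
Variables (G : zmodType) (N : zmodClosed G) (K : nat) (xs : seq G).
Hypothesis NK : forall x, x *+ (n ^ K) \in N.
Hypothesis xs_gen : forall x, exists c : nat -> int, x - \sum_(i < m) xs`_i *~ c i \in N.

(* Coordinates modulo the moment curve point at [tau S]: they kill the [n]-divisible
   direction of the group as [S] grows, so they become integral and constant modulo
   [n ^ K]. *)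
Let w (l : 'I_m) (S : nat) (x : V) : rat :=
  x 0 (lift ord0 l) - (tau S)%:~R ^+ l.+1 * x 0 ord0.
Let wint S x := forall l, w l S x \is a Num.int.
Let rho (S : nat) (x : V) : G := \sum_(l < m) xs`_l *~ Num.floor (w l S x).

Lemma residue_eventually (x : subg rigid) : exists u : {quot N}, exists S0,
  forall S, (S0 <= S)%N -> wint S (val x) /\ \pi_({quot N}) (rho S (val x)) = u.
Proof.
have /asboolP[s [a /intvecP hz]] := valP x; set y : V := val x in hz *.
(* Here [n ^ s] pays for the denominator of coordinate 0, and the remaining [n ^ K] sends the change
   of the floors into [N]. *)
pose S0 := (s + K)%N.
have iX (t : int) k : t%:~R ^+ k = (t ^+ k)%:~R :> rat by rewrite rmorphXn.
have wE S l : w l S y = (y - approx s a) 0 (lift ord0 l)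
    - (tau S)%:~R ^+ l.+1 * (y - approx s a) 0 ord0
    + (a * (tau s ^+ l.+1 - tau S ^+ l.+1))%:~R / n%:R ^+ s.
  by rewrite /w !mxE intrM intrB -!iX; ring.
have wi S : (s <= S)%N -> wint S y.
  move=> sS l; rewrite wE rpredD //.
    by rewrite rpredB ?rpredM ?hz ?rpredX ?intr_int.
  apply/dvdz_natexp/dvdz_mull; rewrite -rpredN opprB; exact/dvdz_exp_sub/tau_coh.
exists (\pi_({quot N}) (rho S0 y)), S0 => S S0S.
have sS0 : (s <= S0)%N by exact: leq_addr.
have sS : (s <= S)%N by exact: leq_trans S0S.
split; first exact: wi.
apply/quotP; rewrite -sumrB; apply: rpred_sum => l _; rewrite -mulrzBr.
have /dvdzP[b hb] := dvdz_exp_sub l.+1 (tau_coh S0S).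
have [e ee] : exists e : int, n%:R ^+ s * y 0 ord0 = e%:~R.
  apply/intrP; rewrite -(subrK (approx s a 0 ord0) (y 0 ord0)) mulrDr rpredD //.
    have := hz ord0; rewrite mxE mxE => h.
    by rewrite rpredM ?rpredX ?natr_int.
  by rewrite !mxE expr0 mulr1 mulrC mulfVK ?expn_neq0 // intr_int.
have -> : Num.floor (w l S y) - Num.floor (w l S0 y) = - (b * e) * (n ^ K)%N%:Z.
  apply: (@intr_inj rat); rewrite intrB !floorK ?wi //.
  have hb' : (tau S)%:~R ^+ l.+1 - (tau S0)%:~R ^+ l.+1 = b%:~R * n%:R ^+ S0 :> rat.
    by rewrite !iX -intrB hb intrM -pmulrn natrX.
  rewrite /w [LHS](_ : _ = - ((tau S)%:~R ^+ l.+1 - (tau S0)%:~R ^+ l.+1) * y 0 ord0); last by ring.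
  by rewrite hb' intrM intrN intrM -ee -pmulrn natrX /S0 exprD; ring.
rewrite mulrzA -pmulrn; exact: NK.
Qed.

Lemma residue : exists th : {additive subg rigid -> {quot N}}, forall u, exists y, th y = u.
Proof.
have [th thP] := boolp.choice residue_eventually.
have thB : zmod_morphism th.
  move=> x y; have [S1 h1] := thP x; have [S2 h2] := thP y; have [S3 h3] := thP (x - y).
  pose S := maxn S1 (maxn S2 S3).
  have [w1 <-] := h1 S (leq_maxl _ _).
  have S2S : (S2 <= S)%N by rewrite /S; lia.
  have S3S : (S3 <= S)%N by rewrite /S; lia.
  have [w2 <-] := h2 S S2S; have [w3 <-] := h3 S S3S.
  rewrite -raddfB; congr (\pi_({quot N}) _); rewrite -sumrB; apply: eq_bigr => l _.
  rewrite -mulrzBr; congr (_ *~ _); apply: (@intr_inj rat); rewrite intrB !floorK //.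
  by rewrite /w raddfB !mxE /=; ring.
pose thM := GRing.isZmodMorphism.Build _ _ th thB.
pose thA : {additive subg rigid -> {quot N}} := HB.pack th thM.
exists thA => u; have [c hc] := xs_gen (repr u).
(* With coordinate 0 equal to 0, [w l S x] is [c l] for every [S]. *)
pose x : V := \row_i if unlift ord0 i is Some l then (c l)%:~R else 0.
have hx : x \in intvec.
  by apply/intvecP => i; rewrite mxE; case: unlift => *; rewrite ?intr_int.
exists (rigid_of hx) => /=; have [S hS] := thP (rigid_of hx).
have [_ <-] := hS S (leqnn S); rewrite -[RHS](reprK u); apply/esym/quotP.
rewrite (_ : rho _ _ = \sum_(i < m) xs`_i *~ c i) //.
apply: eq_bigr => l _; congr (_ *~ _); rewrite /w /= !mxE liftK unlift_none mulr0 subr0.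
exact: intrKfloor.
Qed.
End Residue.

Definition spans_mod_tors (G : zmodType) r (g : 'I_r -> G) : Prop :=
  forall x, exists (D : nat) (c : 'I_r -> int),
    (0 < D)%N /\ x *+ D - \sum_i g i *~ c i \in tors G.

(** The [r] images of the [g i] lie in a hyperplane, as the dimension is [m.+1 > r]; its equation,
    cleared of denominators, is the [P] of [hom_to_rigid]. *)
Lemma hom_to_rigid_rank (G : zmodType) r (g : 'I_r -> G) (f : {additive G -> subg rigid}) :
  (forall h : {additive G -> int}, forall x, h x = 0) ->
  spans_mod_tors g -> (r <= m)%N -> forall x, f x = 0.
Proof.
move=> G0 hg rm; pose F : 'M[rat]_(r, m.+1) := \matrix_(i, j) val (f (g i)) 0 j.
have : kermx F^T != 0.
  rewrite -mxrank_eq0 mxrank_ker -lt0n subn_gt0.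
  by apply: leq_ltn_trans (rank_leq_col _) _; rewrite ltnS.
move=> /rowV0Pn[v /sub_kermxP vF v0].
have [D D0 hD] := common_denom (fun i => v 0 i).
have DQ0 : (D%:R : rat) != 0 by rewrite pnatr_eq0 -lt0n.
pose P : {poly int} := \poly_(i < m.+1) Num.floor (v 0 (inord i) * D%:R).
have PE (i : 'I_m.+1) : (P`_i)%:~R = v 0 i * D%:R.
  by rewrite coef_poly ltn_ord inord_val floorK.
have P0 : P != 0.
  apply: contraNneq v0 => P0; apply/eqP/rowP => i; apply: (mulIf DQ0).
  by rewrite -PE P0 coef0 mxE mul0r.
have coordsE (y : V) : coords y P = D%:R * (y *m v^T) 0 0.
  rewrite mxE mulr_sumr; apply: eq_bigr => i _; rewrite PE !mxE; ring.
apply: (@hom_to_rigid _ _ P) => // [|x]; first exact: size_poly.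
rewrite coordsE; apply/eqP; rewrite mulf_eq0 (negPf DQ0) /=; apply/eqP.
have [E [c [E0 /asboolP[k [k0 ek]]]]] := hg x.
have e1 : f x *+ E = \sum_i f (g i) *~ c i.
  apply/eqP; rewrite -subr_eq0; apply/eqP/rigid_tf/asboolP; exists k; split=> //.
  have <- : f (\sum_i g i *~ c i) = \sum_i f (g i) *~ c i.
    by rewrite raddf_sum; apply: eq_bigr => i _; rewrite raddfMz.
  by rewrite -raddfMn -raddfB -raddfMn ek raddf0.
have vg i : val (f (g i)) *m v^T = 0.
  have /matrixP/(_ 0 i) := vF; rewrite !mxE => e.
  apply/matrixP => a b; rewrite !ord1 !mxE -[RHS]e; apply: eq_bigr => j _.
  by rewrite !mxE mulrC.
have EQ0 : (E%:R : rat) != 0 by rewrite pnatr_eq0 -lt0n.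
apply: (mulfI EQ0); rewrite mulr0.
have -> : E%:R * (val (f x) *m v^T) 0 0 = (val (f x *+ E) *m v^T) 0 0.
  rewrite raddfMn /= -scaler_nat -scalemxAl. by rewrite [RHS]mxE.
rewrite e1 raddf_sum /= mulmx_suml summxE big1 // => i _.
by rewrite [val _]val_rigidMz -scalemxAl vg scaler0 mxE.
Qed.
End Rigid.

(** * Embedding modulo torsion into a rational vector space *)

Lemma locq1_additive (G : zmodType) : zmod_morphism (fun x : G => locq x 1).
Proof.
move=> x y; apply/eqP; rewrite eq_sym subr_eq; apply/eqP.
by rewrite locqD // !mulr1n subrK.
Qed.

Lemma rank_embedding (G : zmodType) r : r0_eq G r ->
  exists iota : {additive G -> 'rV[rat]_r},
    (forall x, iota x = 0 -> x \in tors G) /\ exists g : 'I_r -> G, spans_mod_tors g.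
Proof.
move=> [f [f' fK f'K]].
pose io x := f (locq x 1).
have ioB : zmod_morphism io by move=> x y; rewrite /io locq1_additive raddfB.
pose ioM := GRing.isZmodMorphism.Build _ _ io ioB.
pose ioA : {additive G -> 'rV[rat]_r} := HB.pack io ioM.
have ker x : io x = 0 -> x \in tors G.
  rewrite -(raddf0 f) => /(can_inj fK) /locqP[] // k k0.
  by rewrite mul1n mul0rn => e; apply/asboolP; exists k.
exists ioA; split=> //.
have ex i : exists xd : G * nat, (0 < xd.2)%N /\ io xd.1 = xd.2%:R *: delta_mx 0 i.
  have [x [d [d0 e]]] := locq_surj (f' (delta_mx 0 i)).
  exists (x, d); split=> //=; rewrite -(f'K (delta_mx 0 i)) e -linearZ /io; congr (f _).
  have -> : d%:R = d%:~R / 1%:R :> rat by rewrite divr1 -pmulrn.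
  by rewrite locqZ // mul1n; apply: locq_eq1; rewrite // pmulrn.
have [xd xdP] := boolp.choice ex.
exists (fun i => (xd i).1) => x.
have [D D0 hD] := common_denom (fun i => io x 0 i / (xd i).2%:R).
exists D, (fun i => Num.floor (io x 0 i / (xd i).2%:R * D%:R)); split=> //.
apply: ker; rewrite -[io _]/(ioA _) raddfB raddfMn raddf_sum /=.
apply/eqP; rewrite subr_eq0; apply/eqP; rewrite -scaler_nat {1}[io x]row_sum_delta scaler_sumr.
apply: eq_bigr => i _; have [d0 e] := xdP i.
rewrite -[io (_ *~ _)]/(ioA _) raddfMz /= e -scaler_int floorK // !scalerA; congr (_ *: _).
by field; rewrite pnatr_eq0 -lt0n.
Qed.

(** * Existence of the rigid group *)

Lemma int_infinitely_divisible q (c : int) : (1 < q)%N ->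
  (forall k, ((q ^ k)%N %| c)%Z) -> c = 0.
Proof.
move=> q1 hc; apply/eqP; rewrite -absz_eq0 -leqn0 leqNgt; apply/negP => c0.
have := hc `|c|%N; rewrite dvdzE absz_nat => /(dvdn_leq c0).
by rewrite leqNgt ltn_expl.
Qed.

Section Existence.
Variables (G : zmodType) (r : nat) (iota : {additive G -> 'rV[rat]_r}).
Hypothesis iota_ker : forall x, iota x = 0 -> x \in tors G.

(** With two factors one genericity statement does two jobs: the image of [iota] in the first
    controls maps into [G] modulo torsion, and the integers in the second give transcendence. *)
Let H : zmodType := ('rV[rat]_r * int)%type.
Definition iota_range : {pred H} := [pred u : H | `[< exists x, u.1 = iota x >]].

Fact iota_range_closed : zmod_closed iota_range.
Proof.
split=> [|u v /asboolP[x ex] /asboolP[y ey]]; apply/asboolP.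
  by exists 0; rewrite raddf0.
by exists (x - y); rewrite (raddfB iota) -ex -ey.
Qed.
HB.instance Definition _ := GRing.isZmodClosed.Build H iota_range iota_range_closed.

Lemma rV_int_tf : torsion_free H.
Proof.
move=> [u c] /asboolP[k [k0 e]].
have := congr1 fst e; rewrite raddfMn /= => /eqP; rewrite -scaler_nat scaler_eq0 pnatr_eq0.
rewrite -[k == _]negbK -lt0n k0 /= => /eqP ->.
have := congr1 snd e; rewrite raddfMn /= => /eqP; rewrite mulrn_eq0.
by rewrite -[k == _]negbK -lt0n k0 /= => /eqP ->.
Qed.

Lemma exists_generic_sequence n : (1 < n)%N -> exists tau : nat -> int,
  [/\ forall k l, (k <= l)%N -> ((n ^ k)%N %| tau l - tau k)%Z,
    forall q (P : {poly int}), prime q -> (q %| n)%N ->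
      (forall k, ((q ^ k)%N %| P.[tau k])%Z) -> P = 0 &
    forall (q : nat) (g : seq H), prime q -> (q %| n)%N -> {subset g <= iota_range} ->
      (forall k, qdiv iota_range (q ^ k) (evalz g (tau k))) ->
      forall x, x \in g -> forall k, qdiv iota_range (q ^ k) x].
Proof.
move=> n1; pose T : countType := (nat * seq ('rV[rat]_r * int))%type.
(* The pairs [(q, g)] form a countable set, so all are enumerated; the default value is harmless
   because 0 is not prime. *)
pose task i : nat * seq H := if @unpickle T i is Some t then t else (0%N, [::]).
have [tau [coh gen]] := @exists_generic H iota_range rV_int_tf n n1 task.
have gen' (q : nat) (g : seq H) : prime q -> (q %| n)%N -> {subset g <= iota_range} ->
    (forall k, qdiv iota_range (q ^ k) (evalz g (tau k))) ->
    forall x, x \in g -> forall k, qdiv iota_range (q ^ k) x.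
  by have := gen (@pickle T (q, g)); rewrite /task pickleK.
exists tau; split=> // q P qp qn hP.
pose g : seq H := [seq ((0, c) : H) | c <- P].
have gY : {subset g <= iota_range}.
  by move=> u /mapP[c _ ->]; apply/asboolP; exists 0; rewrite raddf0.
have pairMn (c : int) (j : nat) : ((0, c) : H) *+ j = (0, c *+ j).
  by elim: j => [|j IH]; rewrite ?mulr0n // !mulrS IH; congr pair; rewrite add0r.
have gE t : evalz g t = (0, P.[t]).
  rewrite /evalz size_map horner_coef.
  rewrite (eq_bigr (fun i : 'I_(size P) => ((0, P`_i * t ^+ i) : H))); last first.
    move=> i _; rewrite (nth_map 0) //.
    case: (t ^+ i) => m; first by rewrite -pmulrn pairMn -mulr_natr natz.
    by rewrite NegzE mulrNz -pmulrn pairMn mulrN -[Posz m.+1]natz mulr_natr; congr pair; rewrite oppr0.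
  by elim/big_rec2: _ => // i a b _ ->; congr pair; rewrite add0r.
apply/polyP => i; rewrite coef0; have [iP|iP] := leqP (size P) i; first exact: nth_default.
apply: (int_infinitely_divisible (prime_gt1 qp)) => k.
have gdiv j : qdiv iota_range (q ^ j) (evalz g (tau j)).
  have /dvdzP[c e] := hP j; exists ((0, c) : H).
    by apply/asboolP; exists 0; rewrite raddf0.
  by rewrite gE e pairMn -mulr_natr natz.
have gi : ((0, P`_i) : H) \in g by apply/mapP; exists P`_i => //; apply: mem_nth.
have [[u c] _ e] := gen' q g qp qn gY gdiv _ gi k.
have := congr1 snd e; rewrite raddfMn /= => ->.
by rewrite -mulr_natr natz dvdz_mull.
Qed.
End Existence.

Lemma exists_rigid_group (G : zmodType) r (iota : {additive G -> 'rV[rat]_r})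
    (g : 'I_r -> G) (n K : nat) (N : zmodClosed G) (xs : seq G) :
  (forall x, iota x = 0 -> x \in tors G) -> spans_mod_tors g ->
  (forall h : {additive G -> int}, forall x, h x = 0) -> (1 < n)%N ->
  (forall x, x *+ (n ^ K) \in N) ->
  (forall x, exists c : nat -> int, x - \sum_(i < size xs) xs`_i *~ c i \in N) ->
  exists (C : zmodType) (th : {additive C -> {quot N}}),
  [/\ torsion_free C, forall u, exists y, th y = u,
      forall (f : {additive G -> C}) x, f x = 0,
      forall (h : {additive C -> G}) J y, exists x, h y - x *+ (n ^ J) \in tors G &
      forall h : {additive C -> C}, bijective h ->
        (forall y, h y = y) \/ (forall y, h y = - y)].
Proof.
move=> ker hg G0 n1 NK xs_gen.
have [tau [coh gen_int gen]] := exists_generic_sequence iota n1.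
(* The surjection needs [size xs] coordinates, [Hom(G, C) = 0] needs [r <= m], and [rigid_aut] needs
   [m] positive. *)
pose m := (size xs + r).+1.
have xs_gen' x : exists c : nat -> int, x - \sum_(i < m) xs`_i *~ c i \in N.
  have [c hc] := xs_gen x; exists c; congr (_ \in N): hc; congr (_ - _).
  have sm : (size xs <= m)%N by rewrite /m; lia.
  rewrite (big_ord_widen m (fun i => xs`_i *~ c i) sm) big_mkcond; apply: eq_bigr => i _.
  by case: ltnP => // h; rewrite nth_default // mul0rz.
have [th th_surj] := residue n1 coh NK xs_gen'.
exists _, th; split=> //.
- exact: rigid_tf.
- move=> f x; apply: (hom_to_rigid_rank gen_int f G0 hg); rewrite /m; lia.
- move=> h J y.
  pose h' y : 'rV[rat]_r * int := (iota (h y), 0).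
  have hB : zmod_morphism h' by move=> a b; rewrite /h' !raddfB; congr pair; rewrite subr0.
  pose hM := GRing.isZmodMorphism.Build _ _ h' hB.
  pose hA : {additive _ -> ('rV[rat]_r * int)%type} := HB.pack h' hM.
  have hY z : hA z \in iota_range iota by apply/asboolP; exists (h z).
  have [[u c] /asboolP[x /= ->] /(congr1 fst)] :=
    rigid_hom_divisible (@rV_int_tf r) hY gen J y.
  rewrite raddfMn /= => e; exists x; apply: ker.
  by rewrite raddfB raddfMn e subrr.
- by move=> h; apply: (rigid_aut gen_int).
Qed.

(** * Finite generation and bounded primary torsion *)

Lemma tors_divp (G : zmodType) (x : G) p : (0 < p)%N -> x *+ p \in tors G -> x \in tors G.
Proof.
move=> p0 /asboolP[k [k0 e]]; apply/asboolP; exists (p * k)%N.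
by rewrite muln_gt0 p0 k0 mulrnA.
Qed.

(** Any [r + 1] vectors of a space of dimension [r] are dependent. After denominators are cleared,
    common factors [p] are divided out, since an element with a torsion multiple is torsion. *)
Lemma rank_dependent (G : zmodType) r (iota : {additive G -> 'rV[rat]_r}) (p : nat)
    (x : 'I_r.+1 -> G) : (forall y, iota y = 0 -> y \in tors G) -> prime p ->
  exists c : 'I_r.+1 -> int, (exists i, ~~ (p %| c i)%Z) /\ \sum_i x i *~ c i \in tors G.
Proof.
move=> ker pp; pose A : 'M[rat]_(r.+1, r) := \matrix_i iota (x i).
have : kermx A != 0.
  by rewrite -mxrank_eq0 mxrank_ker -lt0n subn_gt0 ltnS rank_leq_col.
move=> /rowV0Pn[v /sub_kermxP vA v0].
have [D D0 hD] := common_denom (fun i => v 0 i).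
have DQ0 : (D%:R : rat) != 0 by rewrite pnatr_eq0 -lt0n.
have [i0 vi0] : exists i, v 0 i != 0.
  apply: contrapT => h; case/eqP: v0; apply/rowP => i; rewrite mxE; apply/eqP.
  by apply: contrapT => /negP hi; apply: h; exists i.
pose c i := Num.floor (v 0 i * D%:R).
have cE i : (c i)%:~R = v 0 i * D%:R by rewrite floorK.
have cT : \sum_i x i *~ c i \in tors G.
  apply: ker; have -> : iota (\sum_i x i *~ c i) = D%:R *: (v *m A).
    rewrite raddf_sum mulmx_sum_row scaler_sumr; apply: eq_bigr => i _.
    by rewrite raddfMz rowK scalerA -scaler_int cE mulrC.
  by rewrite vA scaler0.
have ci0 : c i0 != 0.
  by rewrite -(intr_eq0 rat) cE mulf_neq0.
move: (c) cT ci0 {-2}`|c i0|%N (erefl `|c i0|%N) => {c cE} c cT ci0 k.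
elim/ltn_ind: k c cT ci0 => k IH c cT ci0 ek.
have [h|h] := pselect (exists i, ~~ (p %| c i)%Z); first by exists c.
have hc i : exists b, c i = b * p%:Z.
  by apply/dvdzP; apply: contrapT => /negP hi; apply: h; exists i.
have [b bE] := boolp.choice hc.
have b0 : b i0 != 0 by apply: contraNneq ci0 => b0; rewrite bE b0 mul0r.
have bk : (`|b i0| < k)%N.
  by rewrite ek bE abszM absz_nat ltn_Pmulr ?prime_gt1 // absz_gt0.
apply: (IH _ bk b) => //.
apply: (@tors_divp _ _ p); first exact: prime_gt0.
rewrite -sumrMnl (eq_bigr (fun i => x i *~ c i)) // => i _.
by rewrite bE mulrzA pmulrn.
Qed.

Definition zcomb (G : zmodType) (xs : seq G) (c : nat -> int) : G :=
  \sum_(i < size xs) xs`_i *~ c i.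

Section Zcomb.
Variable G : zmodType.
Implicit Types (xs ys : seq G) (c : nat -> int).

Lemma zcomb_rcons xs a c : zcomb (rcons xs a) c = zcomb xs c + a *~ c (size xs).
Proof.
rewrite /zcomb size_rcons big_ord_recr /= nth_rcons ltnn eqxx; congr (_ + _).
by apply: eq_bigr => i _; rewrite nth_rcons ltn_ord.
Qed.

Lemma zcomb_cat xs ys c d : exists e, zcomb xs c + zcomb ys d = zcomb (xs ++ ys) e.
Proof.
exists (fun i => if (i < size xs)%N then c i else d (i - size xs)%N).
rewrite /zcomb size_cat big_split_ord /=; congr (_ + _); apply: eq_bigr => i _.
  by rewrite nth_cat ltn_ord.
by rewrite nth_cat !ltnNge leq_addr /= addKn.
Qed.

Lemma zcombN xs c : - zcomb xs c = zcomb xs (fun i => - c i).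
Proof. by rewrite -sumrN; apply: eq_bigr => i _; rewrite mulrNz. Qed.

Lemma zcombMz xs c u : zcomb xs c *~ u = zcomb xs (fun i => c i * u).
Proof. by rewrite mulrz_suml; apply: eq_bigr => i _; rewrite mulrzA. Qed.

Lemma zcomb_map_mulrn xs c m : zcomb xs c *+ m = zcomb [seq x *+ m | x <- xs] c.
Proof.
rewrite -sumrMnl /zcomb size_map; apply: eq_bigr => i _.
by rewrite (nth_map 0) // !pmulrn -!mulrzA mulrC.
Qed.

(** Linear algebra over the field with [p] elements: if no finite family generated [A] modulo [Z],
    elements outside the span could be added until [s] independent ones contradict the dependence
    hypothesis. *)
Lemma fin_gen_mod (A Z : zmodClosed G) (p s : nat) : prime p ->
  (forall a, a \in A -> a *+ p \in Z) ->
  (forall x : 'I_s -> G, (forall i, x i \in A) ->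
     exists c : 'I_s -> int, (exists i, ~~ (p %| c i)%Z) /\ \sum_i x i *~ c i \in Z) ->
  exists2 xs, {subset xs <= A} & forall a, a \in A -> exists c, a - zcomb xs c \in Z.
Proof.
move=> pp pA dep; apply: contrapT => nogen.
have [xs [sx xsA ind]] : exists xs : seq G, [/\ size xs = s, {subset xs <= A} &
    forall c, zcomb xs c \in Z -> forall i, (i < s)%N -> (p %| c i)%Z].
  elim: s {dep} => [|t [xs [sx xsA ind]]]; first by exists [::].
  have [a [aA ha]] : exists a, a \in A /\ forall c, a - zcomb xs c \notin Z.
    apply: contrapT => h; apply: nogen; exists xs => // a aA.
    apply: contrapT => h'; apply: h; exists a; split=> // c; apply/negP => hc.
    by apply: h'; exists c.
  exists (rcons xs a); split=> [||c]; first by rewrite size_rcons sx.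
    by move=> y; rewrite mem_rcons inE => /orP[/eqP->|/xsA].
  rewrite zcomb_rcons sx => hc.
  (* Otherwise [c t] is invertible modulo [p], and [a] lies in the span of [xs] modulo [Z]. *)
  have pc : (p %| c t)%Z.
    apply: contrapT => /negP npc.
    have co : coprime p `|c t|%N by rewrite prime_coprime // -[p]absz_nat -dvdzE.
    have [u [v uv]] : exists u v : int, u * p%:Z + v * c t = 1.
      exists (egcdz p (c t)).1, (egcdz p (c t)).2; case: egcdzP => u v -> _.
      by rewrite /gcdz absz_nat (eqP co).
    case/negP: (ha (fun i => - (c i * v))).
    rewrite -zcombN opprK -zcombMz.
    have -> : a + zcomb xs c *~ v = a *+ p *~ u + (zcomb xs c + a *~ c t) *~ v.
      rewrite mulrzDl_tmp addrCA pmulrn -!mulrzA -mulrzDr_tmp [_ * u]mulrC [_ * v]mulrC uv.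
      by rewrite addrC.
    by rewrite rpredD //; apply: rpredMz => //; apply: pA.
  have hc' : zcomb xs c \in Z.
    move: pc => /dvdzP[b eb]; move: hc; rewrite eb mulrzA -pmulrn rpredDr //.
    by apply: pA; apply: rpredMz.
  move=> i; rewrite ltnS leq_eqVlt => /orP[/eqP-> //|it].
  exact: (ind c hc').
have [i|c [[i hi] hc]] := dep (fun i => xs`_i); first by apply: xsA; rewrite mem_nth ?sx.
case/negP: hi.
pose c' j := if insub j is Some i' then c i' else 0.
have -> : c i = c' i by rewrite /c' valK.
apply: ind => //; congr (_ \in Z): hc; rewrite /zcomb sx; apply: eq_bigr => j _.
by rewrite /c' valK.
Qed.
End Zcomb.

Definition mod_tors (G : zmodType) (m : nat) : {pred G} :=
  [pred x | `[< exists y, x - y *+ m \in tors G >]].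

Section ModTors.
Variables (G : zmodType) (m : nat).

Fact mod_tors_closed : zmod_closed (@mod_tors G m).
Proof.
split=> [|x y /asboolP[x' hx] /asboolP[y' hy]]; apply/asboolP.
  by exists 0; rewrite mul0rn subrr rpred0.
by exists (x' - y'); rewrite mulrnBl subrACB rpredB.
Qed.
HB.instance Definition _ := GRing.isZmodClosed.Build G (@mod_tors G m) mod_tors_closed.

Lemma tors_mod_tors x : x \in tors G -> x \in @mod_tors G m.
Proof. by move=> h; apply/asboolP; exists 0; rewrite mul0rn subr0. Qed.

Lemma mulrn_mod_tors x : x *+ m \in @mod_tors G m.
Proof. by apply/asboolP; exists x; rewrite subrr rpred0. Qed.
End ModTors.


(** For a prime [p], [rank_dependent] bounds the dimension of the quotient by [r]. In general,
    generators for [p] are joined with [p] times generators for [m / p]. *)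
Lemma fin_gen_mod_tors (G : zmodType) r (iota : {additive G -> 'rV[rat]_r}) (m : nat) :
  (forall y, iota y = 0 -> y \in tors G) -> (0 < m)%N ->
  exists xs : seq G, forall x, exists c, x - zcomb xs c \in @mod_tors G m.
Proof.
move=> ker; elim/ltn_ind: m => m IH m0.
have [m1|m1] := leqP m 1.
  exists [::] => x; exists (fun=> 0); apply/asboolP; exists x.
  by rewrite /zcomb big_ord0 subr0 (_ : m = 1%N) ?subrr ?rpred0 //; lia.
have pp := pdiv_prime m1; have em := divnK (pdiv_dvd m); set p := pdiv m in pp em.
have [||ys hys] := IH (m %/ p)%N.
- by rewrite ltn_Pdiv ?prime_gt1.
- by rewrite divn_gt0 ?prime_gt0 // dvdn_leq ?pdiv_dvd.
have predT_closed : zmod_closed (predT : {pred G}) by [].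
pose TM := GRing.isZmodClosed.Build G _ predT_closed.
pose T : zmodClosed G := HB.pack (predT : {pred G}) TM.
have [|x _|xs _ hxs] := @fin_gen_mod G T (@mod_tors G p) p r.+1 pp.
- by move=> a _; apply: mulrn_mod_tors.
- have [c [hc hT]] := rank_dependent x ker pp.
  by exists c; split=> //; apply: tors_mod_tors.
exists (xs ++ [seq y *+ p | y <- ys]) => x.
have [c /asboolP[y hy]] := hxs x isT; have [d /asboolP[z hz]] := hys y.
have [e he] := zcomb_cat xs [seq y *+ p | y <- ys] c d.
exists e; rewrite -he -zcomb_map_mulrn; apply/asboolP; exists z.
have -> : x - (zcomb xs c + zcomb ys d *+ p) - z *+ m =
    (x - zcomb xs c - y *+ p) + (y - zcomb ys d - z *+ (m %/ p)) *+ p.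
  by rewrite -{1}em mulrnA !mulrnBl addrA subrKA opprD addrA.
by rewrite rpredD // rpredMn.
Qed.

(** If [p^e] kills [xs], then [p^e U = p^(e+1) U]. So [p^e U] is [p]-divisible and, being
    [p]-primary, divisible; reducedness makes it zero. *)
Lemma bounded_ptors (G : zmodType) (U : zmodClosed G) (p : nat) (xs : seq G) :
  prime p -> reduced G -> (forall x, x \in U -> exists k, x *+ (p ^ k) = 0) ->
  {subset xs <= U} ->
  (forall x, x \in U -> exists c, qdiv U p (x - zcomb xs c)) ->
  exists e, forall x, x \in U -> x *+ (p ^ e) = 0.
Proof.
move=> pp redG Up xsU gen.
have [e he] : exists e, forall x, x \in xs -> x *+ (p ^ e) = 0.
  elim: xs xsU {gen} => [|x xs IH] xsU; first by exists 0%N.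
  have [y yx|e he] := IH; first by apply: xsU; rewrite inE yx orbT.
  have [|k hk] := Up x; first by apply: xsU; rewrite inE eqxx.
  exists (k + e)%N => y; rewrite inE expnD => /orP[/eqP->|/he h].
    by rewrite mulrnA hk mul0rn.
  by rewrite mulnC mulrnA h mul0rn.
have hz c : zcomb xs c *+ (p ^ e) = 0.
  rewrite zcomb_map_mulrn /zcomb big1 // => i _.
  by rewrite size_map in i *; rewrite (nth_map 0) // he ?mul0rz // mem_nth.
pose D : {pred G} := [pred x | `[< qdiv U (p ^ e) x >]].
have DB : zmod_closed D.
  split=> [|x y /asboolP hx /asboolP hy]; apply/asboolP; first exact: qdiv0.
  exact: qdivB.
pose DM := GRing.isZmodClosed.Build G D DB.
pose DZ : zmodClosed G := HB.pack D DM.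
have DU x : x \in DZ -> x \in U by move=> /asboolP[u uU ->]; apply: rpredMn.
have Dp k x : x \in DZ -> exists2 y, y \in DZ & x = y *+ (p ^ k).
  elim: k x => [|k IH] x; first by exists x.
  move=> /asboolP[u uU eu]; have [c [u' u'U eu']] := gen u uU.
  have [|y yD ey] := IH (u' *+ (p ^ e)); first by apply/asboolP; exists u'.
  exists y => //; rewrite eu -[u](subrK (zcomb xs c)) mulrnDl hz addr0 eu'.
  by rewrite -mulrnA mulnC mulrnA ey -mulrnA -expnSr.
have divD : divisible (subg DZ).
  move=> n n0 x.
  have [n' cop en] := pfactor_coprime pp n0.
  have [y yD ey] := Dp (logn p n) (val x) (valP x).
  have [k hk] := Up y (DU y yD).
  have [z zD ez] : qdiv DZ n' y.
    apply: (@qdiv_coprime _ DZ n' (p ^ k)) => //; first by rewrite coprimeXr // coprime_sym.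
    by rewrite hk; apply: qdiv0.
  exists (exist (fun x => x \in DZ) z zD); apply: val_inj; rewrite raddfMn /=.
  by rewrite ey ez -mulrnA -en.
exists e => x xU; apply: (redG DZ divD). by apply/asboolP; exists x.
Qed.

(** A nonzero [h] has image [d Z] with [d > 0], and an element [y] with [h y = d] generates an
    infinite cyclic complement of the kernel. *)
Lemma no_free_summand_hom (G : zmodType) (h : {additive G -> int}) :
  no_free_summand G -> forall x, h x = 0.
Proof.
move=> nfs x; apply: contrapT => hx.
have ex : exists d : nat, (0 < d)%N && `[< exists y, h y = d%:Z >].
  exists `|h x|%N; rewrite absz_gt0; apply/andP; split; first exact/eqP.
  apply/asboolP; have [le|le] := leP 0 (h x); first by exists x; rewrite gez0_abs.
  by exists (- x); rewrite raddfN ltz0_abs.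
have := ex_minnP ex; case=> d /andP[d0 /asboolP[y hy]] dmin.
pose F : {pred G} := [pred z | `[< exists c : int, z = y *~ c >]].
have FB : zmod_closed F.
  split=> [|a b /asboolP[c ->] /asboolP[c' ->]]; apply/asboolP; first by exists 0; rewrite mulr0z.
  by exists (c - c'); rewrite mulrzBr.
pose FM := GRing.isZmodClosed.Build G F FB.
pose FZ : zmodClosed G := HB.pack F FM.
pose B : {pred G} := [pred z | h z == 0].
have BB : zmod_closed B.
  split=> [|a b]; rewrite !inE ?raddf0 // => /eqP ha /eqP hb.
  by rewrite raddfB ha hb subrr.
pose BM := GRing.isZmodClosed.Build G B BB.
pose BZ : zmodClosed G := HB.pack B BM.
have hyc c : h (y *~ c) = d%:Z * c by rewrite raddfMz hy mulrzz.
have dz0 : d%:Z != 0 by rewrite eqz_nat -lt0n.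
have dvd z : (d %| h z)%Z.
  have e := divz_eq (h z) d.
  rewrite dvdz_eq; apply/eqP; rewrite [RHS]e.
  have [->|m0] := eqVneq (h z %% d)%Z 0; first by rewrite addr0.
  have m1 : (0 <= h z %% d)%Z by rewrite modz_ge0.
  have m2 := ltz_pmod (h z) (d0 : 0 < d%:Z).
  have : (d <= `|(h z %% d)%Z|)%N.
    apply: dmin; rewrite absz_gt0 m0; apply/asboolP; exists (z - y *~ (h z %/ d)%Z).
    by rewrite raddfB hyc gez0_abs // {1}e mulrC addrC addKr.
  by rewrite -lez_nat gez0_abs // leNgt m2.
have ds : is_direct_sum predT FZ BZ.
  split=> [z|z /asboolP[c ->]]; last first.
    rewrite inE hyc mulf_eq0 (negPf dz0) /= => /eqP ->; exact: mulr0z.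
  split=> // _; have /dvdzP[c hc] := dvd z.
  exists (y *~ c), (z - y *~ c); split; last by rewrite addrC subrK.
    by apply/asboolP; exists c.
  by rewrite inE raddfB hyc hc mulrC subrr.
have free : free_group (subg FZ).
  exists unit.
  have inF (c : int) : y *~ c \in FZ by apply/asboolP; exists c.
  pose f (u : dsum unit int) : subg FZ := exist (fun z => z \in FZ) (y *~ val u tt) (inF _).
  have fB : zmod_morphism f by move=> u v; apply: val_inj; rewrite !raddfB /= -mulrzBr.
  pose fM := GRing.isZmodMorphism.Build _ _ f fB.
  pose fA : {additive dsum unit int -> subg FZ} := HB.pack f fM.
  exists fA.
  have fin (c : int) : (fun _ : unit => c) \in @fin_supp unit int.
    by apply/asboolP; apply: finite_finset.
  have surj (z : subg FZ) : exists c, val z = y *~ c by have /asboolP := valP z.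
  have [k hk] := boolp.choice surj.
  exists (fun z => exist (fun g => g \in @fin_supp unit int) _ (fin (k z))).
    move=> u; apply: val_inj; apply: funext => -[] /=.
    have := congr1 h (hk (fA u)); rewrite /= !hyc => /(mulfI dz0) <-; by [].
  by move=> z; apply: val_inj; rewrite /= hk.
have : y = 0 by apply: (nfs FZ BZ ds free); apply/asboolP; exists 1; rewrite mulr1z.
by move=> y0; move: hy dz0; rewrite y0 raddf0 => <-; rewrite eqxx.
Qed.

(** * Bounded primary torsion in [G] *)

Lemma free_group_tf (A : zmodType) : free_group A -> torsion_free A.
Proof.
move=> [I [f [g fK gK]]] x /asboolP[k [k0 e]]; rewrite -(gK x) -(raddf0 f); congr (f _).
apply: val_inj; apply: funext => i.
have valMn (y : dsum I int) j : val (y *+ j) i = val y i *+ j.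
  by elim: j => [|j IH]; rewrite ?mulr0n // !mulrS -IH.
have : val (g x *+ k) i = 0.
  by rewrite (_ : g x *+ k = 0) //; apply: (can_inj fK); rewrite raddfMn gK raddf0.
rewrite valMn => /eqP; rewrite mulrn_eq0.
by rewrite -[k == _]negbK -lt0n k0 /= => /eqP.
Qed.

(** Divisibility of [L / F] writes each element of [T_p(G')] as [p l + f]. Among [r + 1] of them, a
    combination with coefficients not all divisible by [p] has torsion, hence zero, [F]-part, so it
    lies in [p T_p(G')]. *)
Lemma ptors_bounded_of_divisible_quotient (G : zmodType) r (iota : {additive G -> 'rV[rat]_r})
    (G' : zmodClosed G) (F L : zmodClosed (subg G')) (p : nat) :
  (forall y, iota y = 0 -> y \in tors G) -> prime p -> reduced G ->
  free_group (subg F) -> {subset tors (subg G') <= L} -> divisible (quotg L F) ->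
  exists e, forall x, x \in G' -> x \in tors_p G p -> x *+ (p ^ e) = 0.
Proof.
move=> ker pp redG /free_group_tf Ftf TL divLF; have p0 := prime_gt0 pp.
pose U : {pred G} := [pred x | (x \in G') && (x \in tors_p G p)].
have UB : zmod_closed U.
  split=> [|x y /andP[x1 x2] /andP[y1 y2]]; first by apply/andP; rewrite !rpred0.
  by apply/andP; rewrite !rpredB.
pose UM := GRing.isZmodClosed.Build G U UB.
pose UZ : zmodClosed G := HB.pack U UM.
pose pU : {pred G} := [pred x | `[< qdiv UZ p x >]].
have pUB : zmod_closed pU.
  split=> [|x y /asboolP hx /asboolP hy]; apply/asboolP; first exact: qdiv0.
  exact: qdivB.
pose pUM := GRing.isZmodClosed.Build G pU pUB.
pose pUZ : zmodClosed G := HB.pack pU pUM.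
have dep (x : 'I_r.+1 -> G) : (forall i, x i \in UZ) ->
    exists c : 'I_r.+1 -> int, (exists i, ~~ (p %| c i)%Z) /\ \sum_i x i *~ c i \in pUZ.
  move=> xU.
  have ex i : exists lf : subg G' * subg G', lf.2 \in F /\ x i = val (lf.1 *+ p + lf.2).
    have /andP[xG' /asboolP[k hk]] := xU i.
    pose X : subg G' := exist (fun y => y \in G') (x i) xG'.
    have XL : X \in L.
      apply: TL; apply/asboolP; exists (p ^ k)%N; rewrite expn_gt0 p0; split=> //.
      by apply: val_inj; rewrite raddfMn.
    pose Z : subg L := exist (fun y => y \in L) X XL.
    have [u hu] := divLF p p0 (\pi_({quot (@restrictg _ L F)}) Z).
    have [w hw] := quot_surj u.
    have eZ : val (Z - w *+ p) = X - val (w) *+ p by rewrite raddfB raddfMn.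
    exists (val (w), X - val (w) *+ p); split.
      rewrite -eZ; have : Z - w *+ p \in @restrictg _ L F.
        by apply/quotP; rewrite -hu -hw -raddfMn.
      by rewrite inE.
    by rewrite [_.1]/(val (w)) [_.2]/(X - val (w) *+ p) addrC subrK.
  have [lf lfP] := boolp.choice ex.
  have [c [hc hT]] := rank_dependent (fun i => val (lf i).2) ker pp.
  exists c; split=> //.
  pose y := \sum_i (lf i).2 *~ c i; pose z := \sum_i (lf i).1 *~ c i.
  have yF : y \in F by apply: rpred_sum => i _; apply: rpredMz; case: (lfP i).
  have y0 : y = 0.
    move: hT => /asboolP[k [k0 hk]].
    have : (exist (fun y => y \in F) y yF : subg F) \in tors (subg F).
      apply/asboolP; exists k; split=> //; apply: val_inj; rewrite raddfMn /=.
      apply: val_inj; rewrite raddfMn raddf_sum -[RHS]hk; congr (_ *+ _).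
      by apply: eq_bigr => i _; rewrite raddfMz.
    by move=> /Ftf /(congr1 val).
  have e : \sum_i x i *~ c i = val z *+ p.
    rewrite -raddfMn -[z *+ p]addr0 -y0 /z /y -sumrMnl -big_split raddf_sum.
    apply: eq_bigr => i _; have [_ ->] := lfP i.
    by rewrite -raddfMz; congr (val _); rewrite mulrzDl_tmp pmulrn -mulrzA mulrC mulrzA -pmulrn.
  apply/asboolP; exists (val z) => //; apply/andP; split; first exact: valP.
  have : \sum_i x i *~ c i \in UZ by apply: rpred_sum => i _; apply: rpredMz.
  rewrite e => /andP[_ /asboolP[k hk]]; apply/asboolP; exists k.+1.
  by rewrite expnS mulrnA.
have pA a : a \in UZ -> a *+ p \in pUZ by move=> aU; apply/asboolP; exists a.
have [xs xsU hxs] := fin_gen_mod pp pA dep.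
have [|x xU|e he] := bounded_ptors pp redG _ xsU.
- by move=> x /andP[_ /asboolP].
- by have [c /asboolP hc] := hxs x xU; exists c.
by exists e => x xG' xp; apply: he; apply/andP.
Qed.

Lemma ptors_bounded_finite (G : zmodType) (V : zmodClosed G) (p : nat) :
  finite_set [set x : G | x \in V]%classic ->
  exists e, forall x, x \in V -> x \in tors_p G p -> x *+ (p ^ e) = 0.
Proof.
move=> /finite_seqP[s sE].
have ex x : exists k, x \in tors_p G p -> x *+ (p ^ k) = 0.
  have [/asboolP[k hk]|h] := pselect (x \in tors_p G p); first by exists k.
  by exists 0%N => /h.
have [k hk] := boolp.choice ex.
exists (\max_(x <- s) k x)%N => x xV xp.
have xs : x \in s.
  by have : [set` s]%classic x by rewrite -sE.
have le : (k x <= \max_(x <- s) k x)%N by apply: leq_bigmax_seq.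
by rewrite -(subnKC le) expnD mulrnA hk // mul0rn.
Qed.

Lemma primary_bounded (G : zmodType) (n : nat) : (0 < n)%N ->
  (forall p, prime p -> exists e, forall x, x \in tors_p G p -> x *+ (p ^ e) = 0) ->
  exists e, forall (x : G) k, x *+ (n ^ k) = 0 -> x *+ (n ^ e) = 0.
Proof.
move=> n0 hp; elim/ltn_ind: n n0 => n IH n0.
have [n1|n1] := leqP n 1.
  by exists 0%N => x k; rewrite (_ : n = 1%N) ?exp1n //; lia.
have pp := pdiv_prime n1; have en := divnK (pdiv_dvd n); set p := pdiv n in pp en.
have [||e2 he2] := IH (n %/ p)%N.
- by rewrite ltn_Pdiv ?prime_gt1.
- by rewrite divn_gt0 ?prime_gt0 // dvdn_leq ?pdiv_dvd.
have [e1 he1] := hp p pp.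
exists (e1 + e2)%N => x k; rewrite -{1}en expnMn mulrnA => hx.
have h1 : x *+ (p ^ e1) *+ ((n %/ p) ^ k)%N = 0.
  by rewrite -mulrnA mulnC mulrnA; apply: he1; apply/asboolP; exists k.
have h2 := he2 _ _ h1.
have : (p ^ e1 * (n %/ p) ^ e2 %| n ^ (e1 + e2))%N.
  rewrite expnD dvdn_mul ?dvdn_exp2r ?pdiv_dvd //.
  by rewrite -{2}en dvdn_mulr.
by move=> /dvdnP[c ->]; rewrite mulnC mulrnA mulrnA h2 mul0rn.
Qed.

Lemma direct_sum_ptors_bounded (G : zmodType) (V W : zmodClosed G) (p e1 e2 : nat) :
  is_direct_sum predT V W ->
  (forall x, x \in V -> x \in tors_p G p -> x *+ (p ^ e1) = 0) ->
  (forall x, x \in W -> x \in tors_p G p -> x *+ (p ^ e2) = 0) ->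
  forall x, x \in tors_p G p -> x *+ (p ^ (e1 + e2)) = 0.
Proof.
move=> [sum dis] h1 h2 x /asboolP[k].
have [a [b [aV bW ->]]] := (sum x).1 isT; rewrite mulrnDl => /eqP; rewrite addr_eq0 => /eqP e.
have ea : a *+ (p ^ k) = 0.
  by apply: dis; [apply: rpredMn|rewrite e rpredN rpredMn].
have eb : b *+ (p ^ k) = 0 by move/eqP: e; rewrite ea eq_sym oppr_eq0 => /eqP.
have aT : a \in tors_p G p by apply/asboolP; exists k.
have bT : b \in tors_p G p by apply/asboolP; exists k.
by rewrite mulrnDl expnD mulrnA (h1 a) // mulnC mulrnA (h2 b) // !mul0rn addr0.
Qed.

(** * Pullbacks along the rigid group *)


Section Pullback.
Variables (G C : zmodType) (n e : nat).
(** Chosen so that [2 K = e + (e + K + 1)]: one [e] absorbs torsion, one makes quotients unique, and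
    [K + 1] divides out [n^K] and one further [n]. *)
Let K := (2 * e).+1.
Let q := (n ^ K)%N.
Let N := @mod_tors G q.
Variable th : {additive C -> {quot N}}.
Hypothesis n0 : (0 < n)%N.
Hypothesis bounded : forall (x : G) k, x *+ (n ^ k) = 0 -> x *+ (n ^ e) = 0.
Hypothesis th_surj : forall u, exists y, th y = u.
Hypothesis C_tf : torsion_free C.
Hypothesis homGC : forall (f : {additive G -> C}) x, f x = 0.
Hypothesis homCG : forall (h : {additive C -> G}) J y, exists x, h y - x *+ (n ^ J) \in tors G.

Definition pullback (a : {additive G -> G}) : {pred (G * C)%type} :=
  [pred u | \pi_({quot N}) (a u.1) == th u.2].

Fact pullback_closed a : zmod_closed (pullback a).
Proof.
split=> [|u v]; rewrite !inE /= ?raddf0 ?eqxx // => /eqP hu /eqP hv.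
by rewrite !raddfB /= hu hv.
Qed.
HB.instance Definition _ a := GRing.isZmodClosed.Build _ (pullback a) (pullback_closed a).

Lemma additive_tors (H : zmodType) (h : {additive G -> H}) x : x \in tors G -> h x \in tors H.
Proof.
move=> /asboolP[k [k0 hk]]; apply/asboolP; exists k; split=> //.
by rewrite -raddfMn hk raddf0.
Qed.

Lemma additive_mod_tors (a : {additive G -> G}) x : x \in N -> a x \in N.
Proof.
move=> /asboolP[y hy]; apply/asboolP; exists (a y).
by rewrite -raddfMn -raddfB additive_tors.
Qed.

Lemma pullbackP (a : {additive G -> G}) x y : (x, y) \in pullback a <-> \pi_({quot N}) (a x) = th y.
Proof. by rewrite inE; split=> /eqP. Qed.

Lemma pullback_over (a : {additive G -> G}) y : (forall x, exists x', a x' - x \in N) ->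
  exists x, (x, y) \in pullback a.
Proof.
move=> a_surj; have [x hx] := quot_surj (th y); have [x' hx'] := a_surj x.
by exists x'; apply/pullbackP; rewrite -hx; apply/quotP.
Qed.

Lemma pullback_mulrn (a : {additive G -> G}) x : (x *+ q, 0) \in pullback a.
Proof.
apply/pullbackP; rewrite raddf0 -(raddf0 (\pi_({quot N}))); apply/quotP.
by rewrite subr0 raddfMn mulrn_mod_tors.
Qed.

Lemma pullback_snd (a : {additive G -> G}) y : (0, y *+ q) \in pullback a.
Proof.
apply/pullbackP; rewrite raddf0 raddf0 raddfMn; have [x <-] := quot_surj (th y).
rewrite -raddfMn -(raddf0 (\pi_({quot N}))); apply/quotP.
by rewrite sub0r rpredN mulrn_mod_tors.
Qed.

(** A multiple [m] of the order of [t] splits as [m1 m2], where the primes of [m1] divide [n] and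
    [m2] is prime to [n]. Then [n^e] kills [m2 t], so [m2] kills [n^e t], which is thus divisible by
    [n^J]. *)
Lemma tors_mulrn_divisible J t : t \in tors G -> exists t', t *+ (n ^ e) = t' *+ (n ^ J).
Proof.
move=> tT; have /asboolP[m [m0 hm]] := tT.
pose m2 := (m`_(\pi(n)^'))%N; pose m1 := (m`_\pi(n))%N.
have em : m = (m1 * m2)%N by rewrite /m1 /m2 partnC.
have co : coprime (n ^ J) m2.
  by rewrite coprimeXl //; apply: (@pnat_coprime \pi(n)); rewrite ?pnat_pi ?part_pnat.
have h2 : t *+ m2 *+ (n ^ e) = 0.
  apply: (@bounded _ m); rewrite -mulrnA.
  (* A crude exponent: the prime multiplicities in [m1] are at most [m]. *)
  have : (m %| m2 * n ^ m)%N.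
    rewrite {1}em mulnC dvdn_mul //; apply/dvdn_partP; first exact: part_gt0.
    move=> p; rewrite mem_primes => /and3P[pp _ pm].
    have pn : (p %| n)%N.
      have := part_pnat \pi(n) m; rewrite -/m1 => /pnatP h.
      have := h (part_gt0 _ _) p pp pm; by rewrite mem_primes => /and3P[].
    rewrite p_part pfactor_dvdn ?expn_gt0 ?n0 // lognX.
    have l1 : (logn p m1 <= m)%N.
      apply: leq_trans (_ : m1 <= m)%N; first by apply/ltnW/ltn_logl/part_gt0.
      by rewrite dvdn_leq // dvdn_part.
    have l2 : (0 < logn p n)%N by rewrite logn_gt0 mem_primes pp n0.
    by nia.
  by move=> /dvdnP[c ->]; rewrite mulnC mulrnA hm mul0rn.
have [t' _ ht'] : qdiv (tors G) (n ^ J) (t *+ (n ^ e)).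
  apply: (qdiv_coprime co); first exact: rpredMn.
  by rewrite -mulrnA mulnC mulrnA h2; apply: qdiv0.
by exists t'.
Qed.

Section OneMap.
Variables (a b a' b' : {additive G -> G}).
Hypothesis a'a : forall x, a' (a x) - x \in N.
Hypothesis aa' : forall x, a (a' x) - x \in N.
Hypothesis b'b : forall x, b' (b x) - x \in N.
Variable f : {additive subg (pullback a) -> subg (pullback b)}.

Definition pull_left (x : G) : subg (pullback a) :=
  exist (fun u => u \in pullback a) _ (pullback_mulrn a x).

Fact pull_left_additive : zmod_morphism pull_left.
Proof.
move=> x y; apply: val_inj; rewrite raddfB /= mulrnBl; congr pair; by rewrite subr0.
Qed.
HB.instance Definition _ := GRing.isZmodMorphism.Build _ _ pull_left pull_left_additive.

Definition pull_right (y : C) : subg (pullback a) :=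
  exist (fun u => u \in pullback a) _ (pullback_snd a y).

Fact pull_right_additive : zmod_morphism pull_right.
Proof.
move=> x y; apply: val_inj; rewrite raddfB /= mulrnBl; congr pair; by rewrite subr0.
Qed.
HB.instance Definition _ := GRing.isZmodMorphism.Build _ _ pull_right pull_right_additive.

(** The first component of [u] lies in [N], so it is some [q x] up to torsion. Torsion dies in [C],
    and [q x] contributes 0 because [Hom(G, C) = 0]. *)
Lemma pullback_fiber u : (val u).2 = 0 -> (val (f u)).2 = 0.
Proof.
move=> u0; pose h x := (val (f (pull_left x))).2.
have hB : zmod_morphism h by move=> x y; rewrite /h !raddfB.
pose hM := GRing.isZmodMorphism.Build _ _ h hB.
pose hA : {additive G -> C} := HB.pack h hM.
have /eqP := valP u; rewrite u0 raddf0 -(raddf0 (\pi_({quot N}))) => /quotP; rewrite subr0 => aN.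
have : (val u).1 \in N.
  by rewrite -[_.1](subKr (a' (a (val u).1))) rpredB // additive_mod_tors.
move=> /asboolP[x /asboolP[k [k0 hk]]].
have eu : (u - pull_left x) *+ k = 0.
  apply: val_inj; rewrite raddfMn raddfB; apply/eqP; rewrite -pair_eqE; apply/andP; split; apply/eqP.
    by rewrite (raddfMn fst) raddfB.
  by rewrite (raddfMn snd) raddfB /= u0 subrr mul0rn.
have : (val (f (u - pull_left x))).2 \in tors C.
  apply/asboolP; exists k; split=> //.
  by rewrite -(raddfMn snd) -raddfMn -raddfMn eu !raddf0.
by move=> /C_tf; rewrite !raddfB => /eqP; rewrite subr_eq0 => /eqP ->; apply: (homGC hA).
Qed.

Lemma pullback_induced : exists g : {additive C -> C}, forall u, (val (f u)).2 = g (val u).2.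
Proof.
have a_surj x : exists x', a x' - x \in N by exists (a' x).
have [s hs] := boolp.choice (fun y => pullback_over y a_surj).
pose g y := (val (f (exist (fun u => u \in pullback a) _ (hs y)))).2.
have gE u : (val (f u)).2 = g (val u).2.
  rewrite /g; set v := exist _ _ _.
  apply/eqP; rewrite -subr_eq0 -(raddfB snd) -!raddfB; apply/eqP/pullback_fiber.
  by rewrite !raddfB /= subrr.
have gB : zmod_morphism g.
  move=> x y; pose u := exist (fun u => u \in pullback a) _ (hs x) : subg _.
  pose v := exist (fun u => u \in pullback a) _ (hs y) : subg _.
  have uv : (val (u - v)).2 = x - y by rewrite raddfB.
  by rewrite -uv -gE !raddfB.
pose gM := GRing.isZmodMorphism.Build _ _ g gB.
by exists (HB.pack g gM : {additive C -> C}).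
Qed.

Hypothesis f_snd : forall u, (val (f u)).2 = (val u).2.

(* [f] restricted to [N] is divided by [q], up to torsion: the difference with [b' a]
   is a multiple of [n ^ (2 K)], which leaves room to divide uniquely. *)
Lemma pullback_lift : exists eta : {additive G -> G}, forall x (u : subg (pullback a)),
  val u = (x *+ q, 0) ->
  (b' (a x) + eta x *+ n) *+ (n ^ (e + K)) = (val (f u)).1 *+ (n ^ e).
Proof.
pose d x := (val (f (pull_left x))).1 - b' (a x) *+ q.
have dB : zmod_morphism d.
  move=> x y; rewrite /d subrACB -mulrnBl -(raddfB b') -(raddfB a) -(raddfB fst).
  by rewrite -(raddfB val) -(raddfB f) -(raddfB pull_left).
(* If [(x', y)] is the image of [(x, y)], multiply by [q] and split
   [(q x, q y) = (q x, 0) + (0, q y)]. *)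
have dN x : exists z, d x - z *+ (q * q)%N \in tors G.
  have [y hy] := th_surj (\pi_({quot N}) (a x)).
  have uA : (x, y) \in pullback a by apply/pullbackP.
  pose u : subg (pullback a) := exist (fun u => u \in pullback a) _ uA.
  pose x' := (val (f u)).1.
  have : b x' - a x \in N.
    apply/quotP; have /eqP -> := valP (f u); by rewrite f_snd /= hy.
  move=> /(additive_mod_tors b'); rewrite raddfB => hx'.
  have : x' - b' (a x) \in N.
    by rewrite -(subrKA (b' (b x'))) rpredD // -rpredN opprB.
  move=> /asboolP[z1 h1].
  pose h y := (val (f (pull_right y))).1.
  have hB : zmod_morphism h by move=> s t; rewrite /h !raddfB.
  pose hM := GRing.isZmodMorphism.Build _ _ h hB.
  pose hA : {additive C -> G} := HB.pack h hM.
  have [z2 h2] := homCG hA (K + K) y.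
  have e1 : x' *+ q = (val (f (pull_left x))).1 + h y.
    rewrite -(raddfMn fst) -!raddfMn -(raddfD fst) -!raddfD; congr (val (f _)).1.
    apply: val_inj; rewrite raddfMn raddfD /=; apply/eqP; rewrite -pair_eqE; apply/andP.
    by split; apply/eqP; rewrite ?(raddfMn fst) ?(raddfMn snd) /= ?addr0 ?add0r.
  exists (z1 - z2); have -> : d x = (x' - b' (a x)) *+ q - h y.
    by rewrite /d mulrnBl e1 addrAC addrK.
  have -> : (x' - b' (a x)) *+ q - h y - (z1 - z2) *+ (q * q)%N =
      (x' - b' (a x) - z1 *+ q) *+ q - (h y - z2 *+ (n ^ (K + K))).
    by rewrite expnD -/q !mulrnBl -mulrnA subrACB.
  by rewrite rpredB // rpredMn.
(* Multiplication by [n ^ e] makes the torsion error divisible by [n ^ (2 K)]. The factor [n ^ e]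
   kept inside [w] makes [w] unique, hence additive in [x]. *)
have wex x : exists w, (exists z, w = z *+ (n ^ e)) /\ w *+ (n ^ (e + K).+1) = d x *+ (n ^ e).
  have [z hz] := dN x; have [t' ht'] := tors_mulrn_divisible (K + K) hz.
  exists ((z *+ (n ^ e) + t') *+ (n ^ e)); split; first by eexists.
  rewrite -mulrnA -expnD (_ : (e + (e + K).+1)%N = (K + K)%N); last by rewrite /K; lia.
  rewrite mulrnDl -ht' mulrnBl expnD -/q -!mulrnA [(n ^ e * _)%N]mulnC addrC subrK //.
have [eta etaP] := boolp.choice wex.
have uniq (w1 w2 : G) : (exists z, w1 = z *+ (n ^ e)) -> (exists z, w2 = z *+ (n ^ e)) ->
    w1 *+ (n ^ (e + K).+1) = w2 *+ (n ^ (e + K).+1) -> w1 = w2.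
  move=> [z1 ->] [z2 ->] ew; apply/eqP; rewrite -subr_eq0 -mulrnBl.
  apply/eqP; apply: (@bounded _ (e + (e + K).+1)).
  by rewrite expnD mulrnA !mulrnBl ew subrr.
have etaB : zmod_morphism eta.
  move=> x y; have [h1 k1] := etaP x; have [h2 k2] := etaP y; have [h3 k3] := etaP (x - y).
  apply: uniq => //; last by rewrite mulrnBl k1 k2 k3 -mulrnBl dB.
  by case: h1 h2 => z1 -> [z2 ->]; exists (z1 - z2); rewrite mulrnBl.
pose etaM := GRing.isZmodMorphism.Build _ _ eta etaB.
exists (HB.pack eta etaM : {additive G -> G}) => x u eu.
have -> : u = pull_left x by apply: val_inj; rewrite eu.
have [_ /=] := etaP x; rewrite expnS mulrnA => he.
by rewrite mulrnDl he /d mulrnBl -mulrnA -expnD addnC addrC subrK.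
Qed.
End OneMap.
End Pullback.

(** * Isomorphism of the two pullbacks after adding [G] *)

Lemma additive_inverse (A B : zmodType) (f : {additive A -> B}) : bijective f ->
  exists g : {additive B -> A}, cancel f g /\ cancel g f.
Proof.
move=> [g fg gf].
have gB : zmod_morphism g by move=> x y; apply: (can_inj fg); rewrite raddfB !gf.
pose gM := GRing.isZmodMorphism.Build _ _ g gB.
by exists (HB.pack g gM : {additive B -> A}).
Qed.

Definition idadd (G : zmodType) : {additive G -> G} := idfun.

(* Whitehead's lemma: modulo [N], the underlying automorphism of [G * G] is the
   product of elementary matrices with second component [psi x2]. *)
Lemma pullback_isog (G C : zmodType) (n e : nat)
    (th : {additive C -> {quot (@mod_tors G (n ^ (2 * e).+1))}}) (phi psi : {additive G -> G}) :
  (forall x, phi (psi x) - x \in @mod_tors G (n ^ (2 * e).+1)) ->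
  isog (G * subg (pullback th (idadd G)))%type (G * subg (pullback th phi))%type.
Proof.
move=> phipsi.
have to_in (u : G * subg (pullback th (idadd G))) :
    (u.1 - psi (phi u.1 - (val u.2).1), (val u.2).2) \in pullback th phi.
  have /eqP h := valP u.2; apply/pullbackP; rewrite -h; apply/quotP.
  rewrite (raddfB phi) addrAC -opprB rpredN.
  exact: phipsi.
have from_in (u : G * subg (pullback th phi)) :
    (phi ((val u.2).1 + psi u.1) - u.1, (val u.2).2) \in pullback th (idadd G).
  have /eqP h := valP u.2; apply/pullbackP; rewrite -h; apply/quotP.
  rewrite /= (raddfD phi) addrAC [phi _ + _]addrC addrK.
  exact: phipsi.
pose F (u : G * subg (pullback th (idadd G))) : G * subg (pullback th phi) :=
  (phi u.1 - (val u.2).1, exist (fun w => w \in pullback th phi) _ (to_in u)).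
pose F' (u : G * subg (pullback th phi)) : G * subg (pullback th (idadd G)) :=
  ((val u.2).1 + psi u.1, exist (fun w => w \in pullback th (idadd G)) _ (from_in u)).
have FB : zmod_morphism F.
  move=> u v; congr pair; first by rewrite [RHS]subrACB -(raddfB phi).
  apply: val_inj; rewrite [RHS]raddfB.
  have e1 : (u - v).1 - psi (phi (u - v).1 - (val (u - v).2).1) =
      (u.1 - psi (phi u.1 - (val u.2).1)) - (v.1 - psi (phi v.1 - (val v.2).1)).
    by rewrite [RHS]subrACB -(raddfB psi) subrACB -(raddfB phi).
  exact: (congr2 pair e1 (erefl _)).
pose FM := GRing.isZmodMorphism.Build _ _ F FB.
exists (HB.pack F FM : {additive _ -> _}); exists F'.
  move=> [x [[y z] hu]]; congr pair; first by rewrite /= subrK.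
  by apply: val_inj => /=; rewrite subrK subKr.
move=> [x [[y z] hu]]; congr pair; first by rewrite /= subKr.
by apply: val_inj => /=; rewrite subKr addrK.
Qed.

(** Newton iteration: replacing [z] by [z + y (1 - x z)] multiplies the error [1 - x z] by
    [1 - x y], gaining a factor [n], and similarly on the other side. *)
Lemma lift_inverse_expn (R : pzRingType) (n K : nat) (x y : R) :
  (exists a, 1 - x * y = a *+ n) -> (exists a, 1 - y * x = a *+ n) ->
  exists z, (exists a, 1 - x * z = a *+ n ^ K.+1) /\ (exists a, 1 - z * x = a *+ n ^ K.+1).
Proof.
move=> [a ha] [b hb]; elim: K => [|K [z [[c hc] [d hd]]]].
  by exists y; split; [exists a|exists b].
exists (z + y * (1 - x * z)); split.
  exists (a * c); have -> : 1 - x * (z + y * (1 - x * z)) = (1 - x * y) * (1 - x * z).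
    by rewrite mulrDr mulrBl mul1r mulrA opprD addrA.
  by rewrite ha hc mulrnAl mulrnAr -mulrnA -expnSr.
exists (b * d); have -> : 1 - (z + y * (1 - x * z)) * x = (1 - y * x) * (1 - z * x).
  have e : (1 - x * z) * x = x * (1 - z * x) by rewrite mulrBl mulrBr mul1r mulr1 mulrA.
  by rewrite mulrDl -[y * _ * x]mulrA e mulrA [RHS]mulrBl mul1r opprD addrA.
by rewrite hb hd mulrnAl mulrnAr -mulrnA -expnSr.
Qed.

(** * The Walk endomorphism ring *)

Lemma EndW_surj (G : zmodType) (u : EndW G) : exists f : endo G, u = \pi_(EndW G) f.
Proof. exact: rq_surj. Qed.

Lemma EndW_mulE (G : zmodType) (f g : endo G) :
  \pi_(EndW G) f * \pi_(EndW G) g = \pi_(EndW G) (f * g).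
Proof. exact: rq_mulE. Qed.

Lemma EndW_eqP (G : zmodType) (f g : endo G) :
  \pi_(EndW G) f = \pi_(EndW G) g <-> forall x, f x - g x \in tors G.
Proof.
split=> [/rq_eqP /asboolP h x|h]; first exact: h.
by apply/rq_eqP/asboolP.
Qed.

Lemma EndW_mulrnE (G : zmodType) (f : endo G) m :
  \pi_(EndW G) f *+ m = \pi_(EndW G) (f *+ m).
Proof.
elim: m => [|m IH].
  rewrite !mulr0n; apply: (addrI (\pi_(EndW G) (0 : endo G))).
  by rewrite addr0 rq_addE addr0.
by rewrite !mulrS IH; apply: rq_addE.
Qed.

Lemma endo_mulrnE (G : zmodType) (f : endo G) m x : (f *+ m) x = f x *+ m.
Proof. by elim: m => [|m IH]; [rewrite !mulr0n|rewrite !mulrS -IH]. Qed.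

Lemma EndW_inverse_mod (G : zmodType) (phi psi : endo G) m :
  (exists a : EndW G, 1 - \pi_(EndW G) phi * \pi_(EndW G) psi = a *+ m) ->
  forall x, phi (psi x) - x \in @mod_tors G m.
Proof.
move=> [a]; have [al ->] := EndW_surj a; rewrite EndW_mulE EndW_mulrnE => e x.
have e' : \pi_(EndW G) (1 : endo G) = \pi_(EndW G) (al *+ m + phi * psi).
  rewrite -[RHS]rq_addE -[X in X + _]e; by rewrite subrK.
rewrite -rpredN opprB; apply/asboolP; exists (al x).
move/EndW_eqP/(_ x): e'; rewrite opprD addrA endo_mulrnE addrAC; exact.
Qed.

(** Let [q = n^(2 e + 1)]. Up to the factor [n^e], [g] sends [(q x, 0)] to [(q (w x), 0)], and [f]
    sends that to first component [q (v (w x))]. As [f] inverts [g], [v (w x)] and [x] agree after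
    multiplication by a power of [n]. *)
Lemma pullback_lifts_inverse (G C : zmodType) (n e : nat)
    (th : {additive C -> {quot (@mod_tors G (n ^ (2 * e).+1))}}) (a b : {additive G -> G})
    (f : {additive subg (pullback th a) -> subg (pullback th b)})
    (g : {additive subg (pullback th b) -> subg (pullback th a)}) (v w : G -> G) :
  (0 < n)%N -> cancel g f -> (forall u, (val (g u)).2 = (val u).2) ->
  (forall x (u : subg (pullback th a)), val u = (x *+ (n ^ (2 * e).+1), 0) ->
    v x *+ (n ^ (e + (2 * e).+1)) = (val (f u)).1 *+ (n ^ e)) ->
  (forall x (u : subg (pullback th b)), val u = (x *+ (n ^ (2 * e).+1), 0) ->
    w x *+ (n ^ (e + (2 * e).+1)) = (val (g u)).1 *+ (n ^ e)) ->
  forall x, v (w x) - x \in tors G.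
Proof.
move=> n0 gf g_snd hv hw x; set K := (2 * e).+1 in hv hw *.
have /= h1 := hv (w x) (pull_left th a (w x)) erefl.
have /= h2 := hw x (pull_left th b x) erefl.
have e0 : (val (g (pull_left th b x))).2 = 0 by rewrite g_snd.
have e1 : pull_left th a (w x) *+ (n ^ e) = g (pull_left th b x) *+ (n ^ e).
  apply: val_inj; rewrite !raddfMn; apply/eqP; rewrite -pair_eqE; apply/andP; split; apply/eqP.
    by rewrite !(raddfMn fst) -h2 /= -mulrnA -expnD addnC.
  rewrite !(raddfMn snd).
  exact: (congr1 (fun y : C => y *+ (n ^ e)) (esym e0)).
have e2 := congr1 f e1; rewrite !raddfMn gf in e2.
have e2' := congr1 (fun t => fst (val t)) e2.
have e3 : v (w x) *+ (n ^ (e + K)) = x *+ (n ^ (e + K)).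
  rewrite h1; move: e2'; rewrite !(raddfMn val) !(raddfMn fst) => e2'; apply: (etrans e2').
  by rewrite /= -mulrnA -expnD addnC.
apply/asboolP; exists (n ^ (e + K))%N; rewrite expn_gt0 n0; split=> //.
by rewrite mulrnBl e3 subrr.
Qed.

(** * Lifting units by cancellation *)

Theorem corollary4p4 (G : zmodType) (V G' : zmodClosed G)
    (F L K F1 L1 : zmodClosed (subg G')) :
  class_Sstar G ->
  cancellation G ->
  is_direct_sum predT V G' ->
  finite_set [set x : G | x \in V]%classic ->
  pushout_presentation F L K ->
  is_direct_sum L F1 L1 ->
  free_group (subg F1) ->
  no_free_summand (subg L1) ->
  (free_group (subg K) \/
   free_group (subg L) \/
   class_G (subg L1) \/
   (exists n, (n <= 1)%N /\ r0_eq (subg F1) n) \/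
   r0_eq (subg L1) 1 \/
   r0_eq (subg L1) 2) ->
  unit_lifting (EndW G).
Proof.
move=> [[_ [r hr]] redG nfs] canc sumG Vfin [_ [[[Ffree _] _] [_ TL divLF] _ _]] _ _ _ _.
have [iota [ker [g hg]]] := rank_embedding hr.
move=> n n0 u [u' [uu' u'u]].
have [X eX] := rq_surj u; have [Y eY] := rq_surj u'; rewrite {}eX {}eY in uu' u'u *.
have [n1|n1] := leqP n 1.
  (* Here [n = 1] and the quotient ring is zero, so 1 lifts its only element. *)
  exists 1; split; first by exists 1; rewrite mulr1.
  apply/rq_eqP/asboolP; exists (1 - X); rewrite (_ : n = 1%N) //; lia.
have XY : exists a, 1 - X * Y = a *+ n.
  have /rq_eqP/asboolP[a ha] : \pi_(ring_quot (nmul_ideal (EndW G) n)) (X * Y) = \pi 1.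
    by apply: etrans uu'; symmetry; apply: rq_mulE.
  by exists (- a); rewrite mulNrn -ha opprB.
have YX : exists a, 1 - Y * X = a *+ n.
  have /rq_eqP/asboolP[a ha] : \pi_(ring_quot (nmul_ideal (EndW G) n)) (Y * X) = \pi 1.
    by apply: etrans u'u; symmetry; apply: rq_mulE.
  by exists (- a); rewrite mulNrn -ha opprB.
have [e bounded] : exists e, forall (x : G) k, x *+ (n ^ k) = 0 -> x *+ (n ^ e) = 0.
  apply: (primary_bounded n0) => p pp.
  have [e1 h1] := ptors_bounded_finite p Vfin.
  have [e2 h2] := ptors_bounded_of_divisible_quotient ker pp redG Ffree TL divLF.
  by exists (e1 + e2)%N; apply: direct_sum_ptors_bounded sumG h1 h2.
(* The inverse modulo [n] is refined to the precision [n ^ (2 e + 1)] used in the pullbacks. *)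
have [Z [XZ ZX]] := lift_inverse_expn (2 * e) XY YX.
have [phi ephi] := EndW_surj X; have [psi epsi] := EndW_surj Z.
rewrite {}epsi {}ephi {XY YX Y u'u uu'} in XZ ZX *.
have phipsi := EndW_inverse_mod XZ; have psiphi := EndW_inverse_mod ZX.
have q0 : (0 < n ^ (2 * e).+1)%N by rewrite expn_gt0 n0.
have [xs hxs] := fin_gen_mod_tors ker q0.
have G0 (h : {additive G -> int}) x : h x = 0 by exact: no_free_summand_hom.
have [C [th [C_tf th_surj homGC homCG aut]]] :=
  exists_rigid_group ker hg G0 n1 (@mulrn_mod_tors G (n ^ (2 * e).+1)) hxs.
have [f1 f1bij] := canc _ _ (pullback_isog th phipsi).
have [g1 [fg1 gf1]] := additive_inverse f1bij.
have idid x : idadd G (idadd G x) - x \in @mod_tors G (n ^ (2 * e).+1).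
  by rewrite subrr rpred0.
have [cf hcf] := pullback_induced C_tf homGC idid idid f1.
have [cg hcg] := pullback_induced C_tf homGC psiphi phipsi g1.
have cfcg : bijective cf.
  exists cg => y.
    have [x hx] := pullback_over th y (fun x => ex_intro _ x (idid x)).
    by rewrite -[y]/(val (exist (fun u => u \in pullback th (idadd G)) _ hx : subg _)).2
      -hcf -hcg fg1.
  have [x hx] := pullback_over th y (fun x => ex_intro _ (psi x) (phipsi x)).
  by rewrite -[y]/(val (exist (fun u => u \in pullback th phi) _ hx : subg _)).2
    -hcg -hcf gf1.
have [f [k [fk kf f_snd]]] : exists (f : {additive subg (pullback th (idadd G)) -> subg (pullback th phi)})
    (k : {additive subg (pullback th phi) -> subg (pullback th (idadd G))}),
    [/\ cancel f k, cancel k f & forall u, (val (f u)).2 = (val u).2].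
  (* If the automorphism induced on [C] is -1, both maps are negated, so that no sign remains in the
     lift. *)
  case: (aut _ cfcg) => hc.
    by exists f1, g1; split=> // z; rewrite hcf hc.
  exists (- f1), (- g1); split=> [x|x|x].
  - by rewrite /= raddfN /= fg1 opprK.
  - by rewrite /= raddfN /= gf1 opprK.
  - have h := hcf x; rewrite hc in h; rewrite -[RHS]opprK -h.
    exact: (congr1 snd (raddfN val (f1 x))).
have k_snd z : (val (k z)).2 = (val z).2 by rewrite -[in RHS](kf z) f_snd.
have [eta heta] := pullback_lift n0 bounded th_surj homCG psiphi f_snd.
have [zeta hzeta] := pullback_lift n0 bounded th_surj homCG idid k_snd.
(* In [pullback_lift] the composite of [b'] and [a] is [psi] for [f] and [phi] for [k]; hence [w] is
   congruent to [phi] modulo [n]. *)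
pose v : endo G := (psi : endo G) + (eta : endo G) *+ n.
pose w : endo G := (phi : endo G) + (zeta : endo G) *+ n.
have vE x : v x = psi x + eta x *+ n by rewrite -endo_mulrnE.
have wE x : w x = phi x + zeta x *+ n by rewrite -endo_mulrnE.
have hv x (t : subg (pullback th (idadd G))) : val t = (x *+ (n ^ (2 * e).+1), 0) ->
    v x *+ (n ^ (e + (2 * e).+1)) = (val (f t)).1 *+ (n ^ e).
  by rewrite vE; apply: heta.
have hw x (t : subg (pullback th phi)) : val t = (x *+ (n ^ (2 * e).+1), 0) ->
    w x *+ (n ^ (e + (2 * e).+1)) = (val (k t)).1 *+ (n ^ e).
  by rewrite wE; apply: hzeta.
have vw := pullback_lifts_inverse n0 kf k_snd hv hw.
have wv := pullback_lifts_inverse n0 fk f_snd hw hv.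
exists (\pi_(EndW G) w); split.
  by exists (\pi_(EndW G) v); rewrite !EndW_mulE; split; apply/EndW_eqP.
apply/rq_eqP/asboolP; exists (\pi_(EndW G) (zeta : endo G)).
rewrite EndW_mulrnE; apply/eqP; rewrite subr_eq addrC rq_addE; apply/eqP.
by [].
Qed.
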